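(* Let $M$ be a compact Riemannian manifold on which a group $S^1$ of Clifford-Wolf translations acts (freely), let $N=M/S^1$ with the Riemannian metric for which the projection $p:M\to N$ is a Riemannian submersion, and let $\Gamma$ be a finite group of isometries acting freely on $M$, with Riemannian quotient manifold $\overline M=M/\Gamma$. Suppose that the groups $S^1$ and $\Gamma$ commute. Let $\Gamma_1=S^1\cap\Gamma$, let $\overline\Gamma=\Gamma/\Gamma_1$ with its induced isometric action on $N$, and let $\overline N=N/\overline\Gamma$ be the quotient Riemannian orbifold. If the orbifold $\overline N$ is not a Riemannian manifold (i.e. it has singularities), then the Riemannian manifold $\overline M$ admits a quasiregular Killing vector field of constant length.
   Context: A Riemannian manifold means a connected complete $C^\infty$-smooth Riemannian manifold. A Clifford-Wolf translation of $(M,g)$ is an isometry $s$ such that $\rho(x,s(x))$ is constant in $x\in M$, where $\rho$ is the Riemannian distance. Two groups of isometries commute if every element of one commutes with every element of the other. A Killing vector field is a smooth vector field $X$ with $L_Xg=0$; it has constant length if $g(X,X)$ is constant, and such fields are understood to be nontrivial. A Killing field of constant length is quasiregular if all its integral curves are closed and there exist integral curves of different lengths. *)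

(* Defs.v *)
From HB Require Import structures.
From mathcomp Require Import all_boot all_order all_algebra all_fingroup.
From mathcomp Require Import all_classical all_reals all_analysis.
Set Implicit Arguments.
Unset Strict Implicit.
Unset Printing Implicit Defensive.
Import Order.TTheory GRing.Theory Num.Theory.
Import numFieldNormedType.Exports.
Local Open Scope classical_set_scope.
Local Open Scope ring_scope.

(* In finite dimension, C^k on an open set [U] is the continuity on [U] of all
   iterated directional derivatives of order at most [k]. *)
Fixpoint Ck_on (R : realType) (E F : normedModType R) (k : nat) (U : set E)
    (f : E -> F) : Prop :=
  (forall x, U x -> {for x, continuous f}) /\
  if k is k'.+1 then
    (forall x v, U x -> derivable f x v) /\
    (forall v, Ck_on k' U (fun x => 'D_v f x))
  else True.

Definition smooth_on (R : realType) (E F : normedModType R) (U : set E)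
    (f : E -> F) : Prop :=
  forall k, Ck_on k U f.

(* [chart_at x] is a preferred chart around [x]: throughout, a tangent vector at
   [x] is the row vector of its components in that chart. *)
Record smooth_manifold (R : realType) (n : nat) := SmoothManifold {
  manifold_point :> topologicalType;
  chart_index : Type;
  chart_dom : chart_index -> set manifold_point;
  chart : chart_index -> manifold_point -> 'rV[R]_n;
  chart_inv : chart_index -> 'rV[R]_n -> manifold_point;
  chart_at : manifold_point -> chart_index;
  manifold_hausdorff : hausdorff_space manifold_point;
  manifold_second_countable : @second_countable manifold_point;
  chart_atP : forall x, chart_dom (chart_at x) x;
  chart_dom_open : forall i, open (chart_dom i);
  chart_image_open : forall i, open (chart i @` chart_dom i);
  chartK : forall i x, chart_dom i x -> chart_inv i (chart i x) = x;
  chart_continuous : forall i x, chart_dom i x -> {for x, continuous (chart i)};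
  chart_inv_continuous : forall i y, (chart i @` chart_dom i) y ->
    {for y, continuous (chart_inv i)};
  transition_smooth : forall i j,
    smooth_on (chart i @` (chart_dom i `&` chart_dom j))
              (chart j \o chart_inv i)
}.
Arguments chart_index {R n} s.
Arguments chart_dom {R n s} i.
Arguments chart {R n s} i x.
Arguments chart_inv {R n s} i y.
Arguments chart_at {R n s} x.

Definition smooth_map (R : realType) (m n : nat) (M : smooth_manifold R m)
    (N : smooth_manifold R n) (f : M -> N) : Prop :=
  continuous f /\
  forall (i : chart_index M) (j : chart_index N),
    smooth_on (chart i @` (chart_dom i `&` f @^-1` chart_dom j))
              (chart j \o f \o chart_inv i).

(* Smoothness of [(t, x) |-> a t x] on the product manifold [R * M]. *)
Definition smooth_family (R : realType) (m : nat) (M : smooth_manifold R m)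
    (a : R -> M -> M) : Prop :=
  continuous (fun z : R * M => a z.1 z.2) /\
  forall i j : chart_index M,
    smooth_on
      [set z : R * 'rV[R]_m |
        exists x, [/\ chart_dom i x, chart i x = z.2 & chart_dom j (a z.1 x)]]
      (fun z : R * 'rV[R]_m => chart j (a z.1 (chart_inv i z.2))).

Definition tangent_map (R : realType) (m n : nat) (M : smooth_manifold R m)
    (N : smooth_manifold R n) (f : M -> N) (x : M) (v : 'rV[R]_m) : 'rV[R]_n :=
  'D_v (chart (chart_at (f x)) \o f \o chart_inv (chart_at x))
    (chart (chart_at x) x).

(* Change of the components at [x] of a tangent vector, from the chart [i] to
   the chart [j]. *)
Definition coord_change (R : realType) (n : nat) (M : smooth_manifold R n)
    (i j : chart_index M) (x : M) (v : 'rV[R]_n) : 'rV[R]_n :=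
  'D_v (chart j \o chart_inv i) (chart i x).

Definition local_field (R : realType) (n : nat) (M : smooth_manifold R n)
    (X : M -> 'rV[R]_n) (i : chart_index M) (y : 'rV[R]_n) : 'rV[R]_n :=
  let x := chart_inv i y in coord_change (chart_at x) i x (X x).

Definition smooth_field (R : realType) (n : nat) (M : smooth_manifold R n)
    (X : M -> 'rV[R]_n) : Prop :=
  forall i : chart_index M,
    smooth_on (chart i @` chart_dom i) (local_field X i).

Definition gram_inner (R : realType) (n : nat) (g : 'M[R]_n) (v w : 'rV[R]_n)
    : R :=
  (v *m g *m w^T) 0 0.

Definition gram_local (R : realType) (n : nat) (M : smooth_manifold R n)
    (g : M -> 'M[R]_n) (i : chart_index M) (v w : 'rV[R]_n) (y : 'rV[R]_n) : R :=
  let x := chart_inv i y in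
  gram_inner (g x) (coord_change i (chart_at x) x v)
                   (coord_change i (chart_at x) x w).

(* [gram x] is the Gram matrix of the metric in the chart [chart_at x]. *)
Record metric_manifold (R : realType) (n : nat) := MetricManifold {
  underlying_manifold :> smooth_manifold R n;
  gram : underlying_manifold -> 'M[R]_n;
  gram_sym : forall x, (gram x)^T = gram x;
  gram_pos : forall x v, v != 0 -> 0 < gram_inner (gram x) v v;
  gram_smooth : forall i v w,
    smooth_on (chart i @` chart_dom i) (gram_local gram i v w)
}.

Definition inner (R : realType) (n : nat) (M : metric_manifold R n) (x : M)
    (v w : 'rV[R]_n) : R :=
  gram_inner (gram x) v w.

Definition C1_curve (R : realType) (n : nat) (M : smooth_manifold R n)
    (c : R -> M) : Prop :=
  continuous c /\
  forall i : chart_index M, Ck_on 1 (c @^-1` chart_dom i) (chart i \o c).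

Definition velocity (R : realType) (n : nat) (M : smooth_manifold R n)
    (c : R -> M) (t : R) : 'rV[R]_n :=
  'D_(1 : R) (chart (chart_at (c t)) \o c) t.

Definition speed (R : realType) (n : nat) (M : metric_manifold R n)
    (c : R -> M) (t : R) : R :=
  Num.sqrt (inner (c t) (velocity c t) (velocity c t)).

Definition curve_length (R : realType) (n : nat) (M : metric_manifold R n)
    (c : R -> M) (a b : R) : R :=
  \int[@lebesgue_measure R]_(t in `[a, b]) speed c t.

(* [joined x y l]: a piecewise C^1 path of length [l] goes from [x] to [y]. Its
   pieces are restrictions to compact intervals of C^1 curves defined on the
   whole line. *)
Inductive joined (R : realType) (n : nat) (M : metric_manifold R n) (x : M)
    : M -> R -> Prop :=
| joined_refl : joined x x 0
| joined_step (c : R -> M) (a b l : R) :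
    C1_curve c -> a <= b -> joined x (c a) l ->
    joined x (c b) (l + curve_length c a b).

Definition riem_dist (R : realType) (n : nat) (M : metric_manifold R n)
    (x y : M) : R :=
  inf [set l | joined x y l].

Definition dist_complete (R : realType) (n : nat) (M : metric_manifold R n)
    : Prop :=
  forall u : nat -> M,
    (forall e : R, 0 < e -> exists k, forall i j, (k <= i)%N -> (k <= j)%N ->
       riem_dist (u i) (u j) < e) ->
    exists x, (fun i => riem_dist (u i) x) @ \oo --> (0 : R).

Record riemannian_manifold (R : realType) (n : nat) := RiemannianManifold {
  underlying_metric :> metric_manifold R n;
  riemannian_nonempty : [set: underlying_metric] !=set0;
  riemannian_connected : connected [set: underlying_metric];
  riemannian_complete : dist_complete underlying_metric
}.

Definition preserves_metric (R : realType) (m n : nat) (M : metric_manifold R m)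
    (N : metric_manifold R n) (f : M -> N) : Prop :=
  forall x v w,
    inner (f x) (tangent_map f x v) (tangent_map f x w) = inner x v w.

Definition local_isometry (R : realType) (n : nat) (M N : metric_manifold R n)
    (f : M -> N) : Prop :=
  smooth_map f /\ preserves_metric f.

Definition riem_isometry (R : realType) (n : nat) (M N : metric_manifold R n)
    (f : M -> N) : Prop :=
  local_isometry f /\
  exists f' : N -> M, [/\ smooth_map f', cancel f f' & cancel f' f].

Definition riemannian_submersion (R : realType) (m n : nat)
    (M : metric_manifold R m) (N : metric_manifold R n) (p : M -> N) : Prop :=
  let horizontal x v :=
    forall u, tangent_map p x u = 0 -> inner x u v = 0 in
  [/\ smooth_map p,
      forall x w, exists v, tangent_map p x v = w &
      forall x v w, horizontal x v -> horizontal x w ->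
        inner (p x) (tangent_map p x v) (tangent_map p x w) = inner x v w].

Definition clifford_wolf (R : realType) (n : nat) (M : metric_manifold R n)
    (s : M -> M) : Prop :=
  riem_isometry s /\ exists d : R, forall x, riem_dist x (s x) = d.

(* The left-hand side is the Lie derivative of the metric along [X], evaluated
   on the constant fields [v] and [w] of the chart [i]. *)
Definition killing (R : realType) (n : nat) (M : metric_manifold R n)
    (X : M -> 'rV[R]_n) : Prop :=
  smooth_field X /\
  forall (i : chart_index M) (y v w : 'rV[R]_n), (chart i @` chart_dom i) y ->
    let Xi := local_field X i in
    'D_(Xi y) (gram_local (@gram R n M) i v w) y
    + gram_local (@gram R n M) i ('D_v Xi y) w y
    + gram_local (@gram R n M) i v ('D_w Xi y) y = 0.

(* Fields of constant length are required to be nontrivial. *)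
Definition constant_length (R : realType) (n : nat) (M : metric_manifold R n)
    (X : M -> 'rV[R]_n) : Prop :=
  exists2 l : R, 0 < l & forall x, inner x (X x) (X x) = l.

Definition integral_curve (R : realType) (n : nat) (M : smooth_manifold R n)
    (X : M -> 'rV[R]_n) (c : R -> M) : Prop :=
  continuous c /\
  forall t, is_derive t (1 : R) (chart (chart_at (c t)) \o c) (X (c t)).

Definition period (R : realType) (T : Type) (c : R -> T) (l : R) : Prop :=
  0 < l /\ forall t, c (t + l) = c t.

Definition least_period (R : realType) (T : Type) (c : R -> T) (l : R) : Prop :=
  period c l /\ forall l', period c l' -> l <= l'.

(* A Killing field on a complete manifold is a complete vector field, so that
   its maximal integral curves are exactly the integral curves defined on the
   whole line. The length of a closed integral curve is taken over one least
   period. *)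
Definition quasiregular (R : realType) (n : nat) (M : metric_manifold R n)
    (X : M -> 'rV[R]_n) : Prop :=
  [/\ forall x, exists2 c, integral_curve X c & c 0 = x,
      forall c, integral_curve X c -> exists l, period c l &
      exists c1 c2 : R -> M, exists l1 l2 : R,
        [/\ integral_curve X c1, integral_curve X c2,
            least_period c1 l1, least_period c2 l2 &
            curve_length c1 0 l1 != curve_length c2 0 l2]].

(* A smooth action of the circle [R / Z]. *)
Definition circle_action (R : realType) (m : nat) (M : smooth_manifold R m)
    (a : R -> M -> M) : Prop :=
  [/\ forall x, a 0 x = x,
      forall s t x, a (s + t) x = a s (a t x),
      forall x, a 1 x = x &
      smooth_family a].

Definition circle_free (R : realType) (T : Type) (a : R -> T -> T) : Prop :=
  forall t x, a t x = x -> exists k : int, t = k%:~R.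

Definition free_action (gT : finGroupType) (T : Type)
    (to : {action gT &-> T}) : Prop :=
  forall x g, to x g = x -> g = 1%g.

(* [q : T -> Q] is the projection onto the orbit space of [act]. *)
Definition orbit_projection (A T Q : Type) (act : T -> A -> T) (q : T -> Q)
    : Prop :=
  (forall y, exists x, q x = y) /\
  (forall x x', q x = q x' <-> exists g, x' = act x g).

(* The elements of a finite transformation group that act as elements of the
   circle. *)
Definition circle_part (R : realType) (T : Type) (gT : finGroupType)
    (a : R -> T -> T) (to : {action gT &-> T}) : {set gT} :=
  [set g : gT | `[< exists t, forall x, to x g = a t x >]]%SET.

Definition isotropy (gT : finGroupType) (T : Type) (to : {action gT &-> T})
    (y : T) : {set gT} :=
  [set g : gT | `[< to y g = y >]]%SET.

(* For an effective action by isometries, the local group of the quotient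
   orbifold at the class of [y] is the isotropy group of [y], and the orbifold is
   a manifold exactly when all its local groups are trivial. *)
Definition orbifold_singular (gT : finGroupType) (T : Type)
    (to : {action gT &-> T}) (y : T) : Prop :=
  isotropy to y != 1%g.

(* Main.v *)
Require Import Defs.
From HB Require Import structures.
From mathcomp Require Import all_boot all_order all_algebra all_fingroup.
From mathcomp Require Import all_classical all_reals all_analysis.
From mathcomp Require Import ring lra.
Set Implicit Arguments.
Unset Strict Implicit.
Unset Printing Implicit Defensive.
Import Order.TTheory GRing.Theory Num.Theory.
Import numFieldNormedType.Exports.
Local Open Scope classical_set_scope.
Local Open Scope ring_scope.

(* Since [S^1] and [Gamma] commute, the circle acts on [Mbar], and its velocity
   field [X] is Killing. The circle orbits in [M] have constant speed, and the
   displacement of a Clifford-Wolf translation by a small angle is, to first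
   order, this speed times the angle; so all orbits have the same speed and [X]
   has constant length.
   The orbit of [q x] closes up at the times [t] at which [a t x] lies in the
   [Gamma]-orbit of [x], and these are multiples of [1 / #|Gamma|]. At a point
   where such coincidences are fewest, each of them persists nearby, hence
   everywhere, since a map of finite order that is the identity near a point of
   a connected manifold is the identity. A singular point of [Nbar] gives an [x]
   and a [g] in [Gamma] outside [S^1] with [to x g = a t x], a coincidence that
   is not global. The two orbits thus have different least periods, hence
   different lengths. *)

(** * Calculus in normed spaces *)

(** Smoothness is expressed by iterated directional derivatives, so differentiability, the chain
    rule and the symmetry of second derivatives are derived from it. A tangent vector is read in a
    preferred chart that may jump from point to point, so local computations are carried to one
    fixed chart. The first-order estimate of a displacement has an easy half, since an arc of an
    orbit joins its ends. The other half must hold for every path, including those that leave the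
    chart; it comes from a cut-off function that grows along curves hardly faster than length.
    Coincidences can be counted because a coincidence time, reduced modulo 1, takes at most [#|gT|]
    values. Equal periods are excluded as follows: the least period at the point with fewest
    coincidences is a coincidence valid everywhere, and so are its integer multiples. If the two
    periods agreed, [t] would be such a multiple, [a t] would act as some [k] in the finite group,
    and freeness would give [g = k], placing [g] in the circle. *)

Section Ck_closure.
Variables (R : realType) (E : normedModType R).
Implicit Types (U V : set E) (k : nat).

Lemma Ck_on_sub (F : normedModType R) k U V (f : E -> F) :
  V `<=` U -> Ck_on k U f -> Ck_on k V f.
Proof.
elim: k f => [|k IH] f VU /=.
  by move=> [c _]; split => // x /VU; exact: c.
move=> [c [d Df]]; split => [x /VU|]; first exact: c.
by split=> [x v /VU|v]; [exact: d|exact: IH].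
Qed.

(** Each condition in [Ck_on] concerns one point at a time, for a function on the whole space, so
    regularity can be checked on a different set around each point. *)
Lemma Ck_on_local (F : normedModType R) k U (f : E -> F) :
  (forall x, U x -> exists2 V, V x & Ck_on k V f) -> Ck_on k U f.
Proof.
elim: k f => [|k IH] f H /=.
  by split => // x /H[V Vx [c _]]; exact: c.
split => [x /H[V Vx [c _]]|]; first exact: c.
split => [x v /H[V Vx [_ [d _]]]|v]; first exact: d.
by apply: IH => x /H[V Vx [_ [_ D]]]; exists V => //; exact: D.
Qed.

Lemma Ck_on_continuous (F : normedModType R) k U (f : E -> F) x :
  Ck_on k U f -> U x -> {for x, continuous f}.
Proof. by case: k => [|k] [c _]; exact: c. Qed.

Lemma Ck_on_derivable (F : normedModType R) k U (f : E -> F) x v :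
  Ck_on k.+1 U f -> U x -> derivable f x v.
Proof. by move=> [_ [d _]]; exact: d. Qed.

Lemma Ck_on_derive (F : normedModType R) k U (f : E -> F) v :
  Ck_on k.+1 U f -> Ck_on k U ('D_v f).
Proof. by move=> [_ [_ d]]; exact: d. Qed.

Lemma Ck_onW (F : normedModType R) k U (f : E -> F) :
  Ck_on k.+1 U f -> Ck_on k U f.
Proof.
elim: k f => [|k IH] f; first by move=> [c _]; split.
by move=> [c [d D]]; split => //; split => // v; exact/IH/D.
Qed.

Lemma near_open (T : topologicalType) (U : set T) (P : T -> Prop) x :
  open U -> U x -> (forall y, U y -> P y) -> \forall y \near x, P y.
Proof. by move=> oU Ux UP; apply: filterS UP _; exact: open_nbhs_nbhs. Qed.

(** Openness of [U] turns equality on [U] into equality near each of its points, which is what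
    limits and derivatives see. *)
Lemma Ck_on_eq (F : normedModType R) k U (f g : E -> F) :
  open U -> (forall x, U x -> f x = g x) -> Ck_on k U f -> Ck_on k U g.
Proof.
move=> oU; elim: k f g => [|k IH] f g fg H /=.
  split=> // x Ux; rewrite /prop_for /continuous_at -(fg _ Ux).
  apply: cvg_trans (Ck_on_continuous H Ux).
  by apply: near_eq_cvg; exact: (near_open oU Ux fg).
split.
  move=> x Ux; rewrite /prop_for /continuous_at -(fg _ Ux).
  apply: cvg_trans (Ck_on_continuous H Ux).
  by apply: near_eq_cvg; exact: (near_open oU Ux fg).
split=> [x v Ux|v].
  apply: near_eq_derivable (Ck_on_derivable H Ux).
  exact: (near_open oU Ux fg).
apply: IH (Ck_on_derive v H) => x Ux.
apply: near_eq_derive; exact: (near_open oU Ux fg).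
Qed.

Lemma Ck_on_cst (F : normedModType R) k U (c : F) : Ck_on k U (fun=> c).
Proof.
elim: k c => [|k IH] c /=.
  by split => // x _; exact: cst_continuous.
split=> [x _|]; first exact: cst_continuous.
split=> [x v _|v]; first exact: derivable_cst.
rewrite (_ : 'D_v _ = fun=> 0); first exact: IH.
by apply/funext => x; exact: derive_cst.
Qed.

Lemma Ck_onD (F : normedModType R) k U (f g : E -> F) :
  open U -> Ck_on k U f -> Ck_on k U g -> Ck_on k U (fun x => f x + g x).
Proof.
move=> oU; elim: k f g => [|k IH] f g Hf Hg /=.
  split=> // x Ux.
  by apply: continuousD; [case: Hf|case: Hg] => + _; exact.
split.
  by move=> x Ux; apply: continuousD; [case: Hf|case: Hg] => + _; exact.
split=> [x v Ux|v].
  by apply: derivableD; [exact: (Ck_on_derivable Hf Ux)|exact: (Ck_on_derivable Hg Ux)].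
apply: (Ck_on_eq oU _ (IH _ _ (Ck_on_derive v Hf) (Ck_on_derive v Hg))) => x Ux.
rewrite -[fun x => f x + g x]/(f + g) deriveD//.
  exact: (Ck_on_derivable Hf Ux).
exact: (Ck_on_derivable Hg Ux).
Qed.

Lemma Ck_onM k U (f g : E -> R) :
  open U -> Ck_on k U f -> Ck_on k U g -> Ck_on k U (fun x => f x * g x).
Proof.
move=> oU; elim: k f g => [|k IH] f g Hf Hg /=.
  split=> // x Ux.
  by apply: continuousM; [case: Hf|case: Hg] => + _; exact.
have df x v : U x -> derivable f x v by move=> Ux; exact: (Ck_on_derivable Hf Ux).
have dg x v : U x -> derivable g x v by move=> Ux; exact: (Ck_on_derivable Hg Ux).
split.
  by move=> x Ux; apply: continuousM; [case: Hf|case: Hg] => + _; exact.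
split=> [x v Ux|v].
  by apply: derivableM; [exact: df|exact: dg].
pose h := fun x => (f x * 'D_v g x) + (g x * 'D_v f x).
apply: (@Ck_on_eq _ _ _ h) => //.
  move=> x Ux; rewrite -[fun x => f x * g x]/(f * g) deriveM//.
  exact: df. exact: dg.
exact (Ck_onD oU (IH _ _ (Ck_onW Hf) (Ck_on_derive v Hg))
  (IH _ _ (Ck_onW Hg) (Ck_on_derive v Hf))).
Qed.

Lemma Ck_on_sum (F : normedModType R) k U (I : Type) (r : seq I) (P : pred I)
    (f : I -> E -> F) :
  open U -> (forall i, Ck_on k U (f i)) ->
  Ck_on k U (fun x => \sum_(i <- r | P i) f i x).
Proof.
move=> oU H; elim: r => [|i r IH].
  rewrite (_ : (fun _ => _) = fun=> 0); first exact: Ck_on_cst.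
  by apply/funext => x; rewrite big_nil.
rewrite (_ : (fun _ => _) =
  fun x => (if P i then f i x else 0) + \sum_(i <- r | P i) f i x); last first.
  by apply/funext => x; rewrite big_cons; case: ifP => // _; rewrite add0r.
by apply: Ck_onD => //; case: (P i) => //; exact: Ck_on_cst.
Qed.

Lemma Ck_on_prod k U (I : Type) (r : seq I) (P : pred I) (f : I -> E -> R) :
  open U -> (forall i, Ck_on k U (f i)) ->
  Ck_on k U (fun x => \prod_(i <- r | P i) f i x).
Proof.
move=> oU H; elim: r => [|i r IH].
  rewrite (_ : (fun _ => _) = fun=> 1); first exact: Ck_on_cst.
  by apply/funext => x; rewrite big_nil.
rewrite (_ : (fun _ => _) =
  fun x => (if P i then f i x else 1) * \prod_(i <- r | P i) f i x); last first.
  by apply/funext => x; rewrite big_cons; case: ifP => // _; rewrite mul1r.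
by apply: Ck_onM => //; case: (P i) => //; exact: Ck_on_cst.
Qed.

Lemma Ck_onV k U (f : E -> R) :
  open U -> (forall x, U x -> f x != 0) -> Ck_on k U f ->
  Ck_on k U (fun x => (f x)^-1).
Proof.
move=> oU f0; elim: k f f0 => [|k IH] f f0 Hf /=.
  by split=> // x Ux; apply: continuousV; [exact: f0|case: Hf => + _; exact].
have df x v : U x -> derivable f x v by move=> Ux; exact: (Ck_on_derivable Hf Ux).
split; first by move=> x Ux; apply: continuousV; [exact: f0|case: Hf => + _; exact].
split=> [x v Ux|v]; first by apply: derivableV; [exact: f0|exact: df].
apply: (@Ck_on_eq _ _ _ (fun x => (-1 * ((f x)^-1 * (f x)^-1)) * 'D_v f x)) => //.
  move=> x Ux; rewrite (deriveV (f0 _ Ux) (df _ _ Ux)).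
  by rewrite mulN1r expr2 invfM.
have Vk := IH f f0 (Ck_onW Hf).
apply: Ck_onM => //; last exact: Ck_on_derive.
by apply: Ck_onM => //; [exact: Ck_on_cst|exact: Ck_onM].
Qed.

Lemma continuous_mxP m n (f : E -> 'M[R]_(m, n)) x :
  (forall i j, {for x, continuous (fun y => f y i j)}) -> {for x, continuous f}.
Proof.
move=> H A [P PM PA]; rewrite nbhs_filterE /=.
apply: (@filterS _ _ _ [set y | forall i j, P i j (f y i j)]).
  by move=> y Hy; exact: PA.
apply: filter_forall => i; apply: filter_forall => j.
exact: (H i j _ (PM i j)).
Qed.

Lemma Ck_on_mx k U m n (f : E -> 'M[R]_(m, n)) :
  open U -> (forall i j, Ck_on k U (fun x => f x i j)) -> Ck_on k U f.
Proof.
move=> oU; elim: k f => [|k IH] f H.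
  by split=> // x Ux; apply: continuous_mxP => i j; exact: Ck_on_continuous (H i j) Ux.
split.
  by move=> x Ux; apply: continuous_mxP => i j; exact: Ck_on_continuous (H i j) Ux.
have df x v : U x -> derivable f x v.
  by move=> Ux; apply/derivable_mxP => i j; exact: (Ck_on_derivable (H i j) Ux).
split=> // v; apply: IH => i j.
apply: (Ck_on_eq oU _ (Ck_on_derive v (H i j))) => // x Ux.
by rewrite (derive_mx (df _ _ Ux)) mxE.
Qed.

Lemma Ck_on_coord k U m n (f : E -> 'M[R]_(m, n)) i j :
  open U -> Ck_on k U f -> Ck_on k U (fun x => f x i j).
Proof.
move=> oU; have cf (g : E -> 'M[R]_(m, n)) x :
    {for x, continuous g} -> {for x, continuous (fun x => g x i j)}.
  by move=> cg; apply: (@continuous_comp _ _ _ g (fun M : 'M[R]_(m, n) => M i j)) => //;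
    exact: coord_continuous.
elim: k f => [|k IH] f H.
  by split=> // x Ux; apply/cf; exact: Ck_on_continuous H Ux.
have df x v : U x -> derivable f x v by move=> Ux; exact: (Ck_on_derivable H Ux).
split; first by move=> x Ux; apply/cf; exact: Ck_on_continuous H Ux.
split=> [x v Ux|v]; first by have /derivable_mxP := df _ v Ux.
apply: (Ck_on_eq oU _ (IH _ (Ck_on_derive v H))) => // x Ux.
by rewrite (derive_mx (df _ _ Ux)) mxE.
Qed.

End Ck_closure.

(** * Differentiability, Lipschitz bounds and composition of C^1 maps *)

Section C1_calculus.
Variable R : realType.

Lemma derivable_lineP (E F : normedModType R) (f : E -> F) (x v : E) (t : R) :
  derivable (fun s : R => f (s *: v + x)) t 1 <-> derivable f (t *: v + x) v.
Proof.
rewrite /derivable; set g1 := fun h => h^-1 *: _; set g2 := fun h => h^-1 *: _.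
suff -> : g1 = g2 by [].
by apply/funext => h; rewrite /g1 /g2 /= [h *: 1]mulr1 scalerDl addrA.
Qed.

Lemma derive_line (E F : normedModType R) (f : E -> F) (x v : E) (t : R) :
  'D_1 (fun s : R => f (s *: v + x)) t = 'D_v f (t *: v + x).
Proof.
rewrite /derive; set g1 := fun h => h^-1 *: _; set g2 := fun h => h^-1 *: _.
suff -> : g1 = g2 by [].
by apply/funext => h; rewrite /g1 /g2 /= [h *: 1]mulr1 scalerDl addrA.
Qed.

Lemma is_derive_line (E F : normedModType R) (f : E -> F) (x v : E) (t : R) :
  derivable f (t *: v + x) v ->
  is_derive t 1 (fun s : R => f (s *: v + x)) ('D_v f (t *: v + x)).
Proof.
by move=> df; split; [exact: (derivable_lineP _ _ _ _).2|exact: derive_line].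
Qed.

(** Homogeneity in the direction comes from the restriction of [f] to the line through [x] along
    [v]: in one variable derivability is differentiability, so the differential is linear. *)
Lemma is_derive_scale (E F : normedModType R) (f : E -> F) (x v : E) (c : R) :
  derivable f x v -> is_derive x (c *: v) f (c *: 'D_v f x).
Proof.
move=> df; pose g (s : R) := f (s *: v + x).
have dg : differentiable g 0.
  by apply/derivable1_diffP/derivable_lineP; rewrite scale0r add0r.
have gE : (fun h : R => h^-1 *: ((g \o shift 0) (h *: c) - g 0)) =
          (fun h : R => h^-1 *: ((f \o shift x) (h *: (c *: v)) - f x)).
  by apply/funext => h; rewrite /g /= addr0 scale0r add0r scalerA.
have dc : derivable g 0 c by exact: diff_derivable.
split; first by move: dc; rewrite /derivable gE.
have : 'D_c g 0 = c *: 'D_1 g 0.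
  by rewrite !deriveE// -[in LHS](mulr1 c) -[c * 1]/(c *: 1) linearZ.
by rewrite derive_line scale0r add0r /derive gE.
Qed.

Lemma mvt_dir (E : normedModType R) (f : E -> R) (x v : E) :
  (forall t : R, 0 <= t <= 1 -> derivable f (t *: v + x) v) ->
  exists2 t : R, 0 <= t <= 1 & f (v + x) - f x = 'D_v f (t *: v + x).
Proof.
move=> df.
have d (t : R) : 0 <= t <= 1 ->
    is_derive t 1 (fun s : R => f (s *: v + x)) ('D_v f (t *: v + x)).
  by move=> t01; exact/is_derive_line/df.
have [|||t] := @MVT_segment R (fun s : R => f (s *: v + x))
    (fun t => 'D_v f (t *: v + x)) 0 1.
- exact: ler01.
- by move=> t; rewrite in_itv /= => /andP[t0 t1]; apply: d; rewrite !ltW.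
- apply: derivable_within_continuous => t; rewrite in_itv /= => t01.
  by have [] := d _ t01.
rewrite in_itv /= scale1r scale0r add0r subr0 mulr1 => t01 ->.
by exists t.
Qed.

Lemma row_norm_le m n (v : 'M[R]_(m, n)) i j : `|v i j| <= `|v|.
Proof. by rewrite [leRHS]/Num.Def.normr/= mx_normrE (le_bigmax _ _ (i, j)). Qed.

Lemma row_norm_leP m n (v : 'M[R]_(m, n)) (d : R) :
  0 <= d -> (forall i j, `|v i j| <= d) -> `|v| <= d.
Proof.
move=> d0 H; rewrite [leLHS]/Num.Def.normr/= mx_normrE bigmax_le// => -[i j] _; exact: H.
Qed.

Lemma row_norm_ltP m n (v : 'M[R]_(m, n)) (d : R) :
  0 < d -> (forall i j, `|v i j| < d) -> `|v| < d.
Proof.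
move=> d0 H; rewrite [ltLHS]/Num.Def.normr/= mx_normrE bigmax_lt// => -[i j] _; exact: H.
Qed.

Lemma near_forall (I : finType) (T : topologicalType) (x : T) (P : I -> T -> Prop) :
  (forall i, \forall y \near x, P i y) -> \forall y \near x, forall i, P i y.
Proof. by move=> H; exact: (@filter_forall T I P (nbhs x) _ H). Qed.

Lemma near_norm_ball (E : normedModType R) (x : E) (P : E -> Prop) :
  (\forall y \near x, P y) -> exists2 d : R, 0 < d & forall y, `|x - y| < d -> P y.
Proof. by move=> /nbhs_normP[d d0 H]; exists d => // y xy; exact: H. Qed.

Lemma near_of_ball (E : normedModType R) (x : E) (P : E -> Prop) (d : R) :
  0 < d -> (forall y, `|x - y| < d -> P y) -> \forall y \near x, P y.
Proof. by move=> d0 H; apply/nbhs_normP; exists d => // y; exact: H. Qed.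

(** Strict differentiability. Passing from [z] to [y] one coordinate at a time, each increment is
    given by a partial derivative at an intermediate point, close to the one at [x] by continuity.
    The intermediate points stay in the ball because the norm is the maximum of the coordinates.
    Letting both points vary is what yields Lipschitz bounds and the control of iterates. *)
Lemma C1_strict_scalar n (U : set 'rV[R]_n) (f : 'rV[R]_n -> R)
    (x : 'rV[R]_n) (e : R) :
  open U -> Ck_on 1 U f -> U x -> 0 < e ->
  exists2 d : R, 0 < d & forall y z, `|x - y| < d -> `|x - z| < d ->
    `|f y - f z - \sum_j (y - z) 0 j * 'D_(delta_mx 0 j) f x| <= e * `|y - z|.
Proof.
(* Each of the [n] coordinate steps contributes an error of at most [en] times the norm of [y - z];
   dividing by [n + 1] covers [n = 0]. *)
move=> oU fC1 Ux e0; pose en := e / n.+1%:R.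
have en0 : 0 < en by rewrite divr_gt0.
have H1 : \forall y \near x, U y /\ forall j : 'I_n,
    `|'D_(delta_mx 0 j) f x - 'D_(delta_mx 0 j) f y| < en.
  suff H : \forall y \near x, forall j : 'I_n,
      `|'D_(delta_mx 0 j) f x - 'D_(delta_mx 0 j) f y| < en.
    exact: (filterI (open_nbhs_nbhs (conj oU Ux)) H).
  apply: near_forall => j.
  have := Ck_on_continuous (Ck_on_derive (delta_mx 0 j) fC1) Ux.
  by move=> /cvgrPdist_lt/(_ _ en0).
have [d d0 Hd] := near_norm_ball H1.
exists d => // y z xy xz.
pose p (k : nat) : 'rV[R]_n := \row_j if (j < k)%N then y 0 j else z 0 j.
have pn : p n = y by apply/rowP => j; rewrite mxE ltn_ord.
have p0 : p 0%N = z by apply/rowP => j; rewrite mxE ltn0.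
have -> : f y - f z = \sum_(k < n) (f (p k.+1) - f (p k)).
  by have := telescope_sumr (fun k => f (p k)) (leq0n n); rewrite pn p0 big_mkord.
rewrite -sumrB.
have step (k : 'I_n) : `|f (p k.+1) - f (p k) -
    (y - z) 0 k * 'D_(delta_mx 0 k) f x| <= en * `|y - z|.
  pose h := (y - z) 0 k; pose v : 'rV[R]_n := h *: delta_mx 0 k.
  have pS : p k.+1 = v + p k.
    apply/rowP => j; rewrite !mxE /= ltnS leq_eqVlt.
    have [->|jk] := eqVneq j k; first by rewrite eqxx /= ltnn /h !mxE mulr1 subrK.
    by rewrite mulr0 add0r (inj_eq val_inj) (negbTE jk).
  have near_t (t : R) : 0 <= t <= 1 -> `|x - (t *: v + p k)| < d.
    move=> /andP[t0 t1]; apply: row_norm_ltP => // i j; rewrite ord1 !mxE /=.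
    have xyj : `|x 0 j - y 0 j| < d.
      by apply: le_lt_trans xy; have := row_norm_le (x - y) 0 j; rewrite !mxE.
    have xzj : `|x 0 j - z 0 j| < d.
      by apply: le_lt_trans xz; have := row_norm_le (x - z) 0 j; rewrite !mxE.
    have [jk|jk] := eqVneq j k; last by rewrite !mulr0 add0r; case: ifP.
    rewrite {}jk in xyj xzj *; rewrite ltnn mulr1 /h !mxE.
    have -> : x 0 k - (t * (y 0 k - z 0 k) + z 0 k) =
      t * (x 0 k - y 0 k) + (1 - t) * (x 0 k - z 0 k) by ring.
    apply: le_lt_trans (ler_normD _ _) _; rewrite !normrM (ger0_norm t0).
    rewrite (@ger0_norm _ (1 - t)) ?subr_ge0//.
    pose mx := Num.max `|x 0 k - y 0 k| `|x 0 k - z 0 k|.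
    have mxd : mx < d by rewrite gt_max xyj.
    apply: le_lt_trans mxd; rewrite (_ : mx = t * mx + (1 - t) * mx); last by ring.
    by apply: lerD; apply: ler_wpM2l; rewrite ?subr_ge0// le_max lexx ?orbT.
  have [t t01] := @mvt_dir _ f (p k) v (fun t t01 =>
    @ex_derive _ _ _ _ _ _ _ (is_derive_scale h (Ck_on_derivable fC1 (Hd _ (near_t t t01)).1))).
  rewrite -pS => ->; have [Ut /(_ k) Dt] := Hd _ (near_t t t01).
  have -> : 'D_v f (t *: v + p k) = h * 'D_(delta_mx 0 k) f (t *: v + p k).
    by have [_ ->] := is_derive_scale h (Ck_on_derivable (v := delta_mx 0 k) fC1 Ut).
  rewrite -/h -mulrBr normrM mulrC ler_pM//; last exact: row_norm_le.
  by rewrite distrC ltW.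
apply: le_trans (ler_norm_sum _ _ _) _.
apply: le_trans (ler_sum _ (fun i _ => step i)) _.
rewrite sumr_const card_ord -mulr_natl mulrA ler_wpM2r// /en mulrCA.
by rewrite ler_piMr ?(ltW e0)// ler_pdivrMr ?ltr0n// mul1r ler_nat.
Qed.

Lemma diff_of_small (V W : normedModType R) (f : V -> W) (x : V)
    (L : {linear V -> W}) :
  continuous L ->
  (forall e : R, 0 < e ->
    \forall h \near 0, `|f (h + x) - f x - L h| <= e * `|h|) ->
  differentiable f x /\ forall v, 'D_v f x = L v.
Proof.
move=> cL H.
have dE : f \o shift x = cst (f x) + L +o_ 0 id.
  apply/eqaddoP => e e0; apply: filterS (H e e0) => h.
  suff -> : (f \o shift x - (cst (f x) + L)) h = f (h + x) - f x - L h by [].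
  by rewrite -addrA -opprD.
have dfE : 'd f x = L :> (_ -> _) by exact: (@diff_unique _ _ _ f L x cL dE).
have df : differentiable f x by apply/diff_locallyP; rewrite dfE.
by split=> // v; rewrite deriveE// dfE.
Qed.

Lemma C1_differentiable_scalar n (U : set 'rV[R]_n) (f : 'rV[R]_n -> R)
    (x : 'rV[R]_n) :
  open U -> Ck_on 1 U f -> U x -> differentiable f x.
Proof.
move=> oU fC1 Ux.
pose L (v : 'rV[R]_n) := \sum_j v 0 j * 'D_(delta_mx 0 j) f x.
have linL : linear L.
  move=> c u v; rewrite /L scaler_sumr -big_split /=; apply: eq_bigr => j _.
  by rewrite !mxE mulrDl scalerAl.
pose LM := GRing.isLinear.Build _ _ _ _ _ linL.
pose Ll : {linear _ -> _} := HB.pack L LM.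
have cL : continuous L.
  move=> v; apply: differentiable_continuous.
  rewrite (_ : L = \sum_(j < n) (fun v : 'rV[R]_n => v 0 j *: 'D_(delta_mx 0 j) f x)).
    by apply: differentiable_sum => j; exact/differentiableZl/differentiable_coord.
  by apply/funext => w; rewrite fct_sumE.
apply: (@diff_of_small _ _ f x Ll cL _).1 => e e0.
have [d d0 Hd] := C1_strict_scalar oU fC1 Ux e0.
apply/nbhs_normP; exists d => // h; rewrite /= sub0r normrN => hd.
have := Hd (h + x) x; rewrite addrK; apply; last by rewrite subrr normr0.
by rewrite opprD addrCA subrr addr0 normrN.
Qed.

Lemma diff_rV (E : normedModType R) n (f : E -> 'rV[R]_n) x :
  (forall j, differentiable (fun y => f y 0 j) x) -> differentiable f x.
Proof.
move=> H.
rewrite (_ : f = \sum_(j < n) (fun y : E => f y 0 j *: (delta_mx 0 j : 'rV[R]_n))).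
  by apply: differentiable_sum => j; apply: differentiableZl; exact: H.
by apply/funext => y; rewrite fct_sumE {1}[f y]row_sum_delta.
Qed.

Lemma C1_differentiable m n (U : set 'rV[R]_m) (f : 'rV[R]_m -> 'rV[R]_n) x :
  open U -> Ck_on 1 U f -> U x -> differentiable f x.
Proof.
move=> oU fC1 Ux; apply: diff_rV => j.
exact: C1_differentiable_scalar oU (Ck_on_coord 0 j oU fC1) Ux.
Qed.

Lemma derive_rV_sum (F : normedModType R) n (f : 'rV[R]_n -> F) x v :
  differentiable f x ->
  'D_v f x = \sum_j v 0 j *: 'D_(delta_mx 0 j) f x.
Proof.
move=> df; rewrite deriveE// [v in LHS]row_sum_delta linear_sum.
by apply: eq_bigr => j _; rewrite linearZ -deriveE.
Qed.

Lemma derive_coord (E : normedModType R) n (f : E -> 'rV[R]_n) (x v : E) j :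
  derivable f x v -> ('D_v f x) 0 j = 'D_v (fun y => f y 0 j) x.
Proof. by move=> /derive_mx ->; rewrite mxE. Qed.

Lemma C1_strict m n (U : set 'rV[R]_m) (f : 'rV[R]_m -> 'rV[R]_n) x (e : R) :
  open U -> Ck_on 1 U f -> U x -> 0 < e ->
  exists2 d : R, 0 < d & forall y z, `|x - y| < d -> `|x - z| < d ->
    `|f y - f z - 'D_(y - z) f x| <= e * `|y - z|.
Proof.
move=> oU fC1 Ux e0.
have H j : exists d : R, 0 < d /\ forall y z, `|x - y| < d -> `|x - z| < d ->
    `|f y 0 j - f z 0 j - ('D_(y - z) f x) 0 j| <= e * `|y - z|.
  have fjC1 := Ck_on_coord 0 j oU fC1.
  have [d d0 Hd] := C1_strict_scalar oU fjC1 Ux e0.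
  exists d; split => // y z xy xz; have := Hd y z xy xz.
  rewrite derive_coord; last exact: Ck_on_derivable fC1 Ux.
  by rewrite (derive_rV_sum _ (C1_differentiable_scalar oU fjC1 Ux)).
have [d Hd] := choice H.
exists (\big[Num.min/1]_j d j).
  by apply: lt_bigmin => // j _; exact: (Hd j).1.
move=> y z xy xz; apply: row_norm_leP; first by rewrite mulr_ge0// ltW.
move=> i j; rewrite ord1 !mxE; apply: (Hd j).2.
  by apply: lt_le_trans xy _; exact: bigmin_le_cond.
by apply: lt_le_trans xz _; exact: bigmin_le_cond.
Qed.

Lemma C1_lipschitz m n (U : set 'rV[R]_m) (f : 'rV[R]_m -> 'rV[R]_n) x :
  open U -> Ck_on 1 U f -> U x ->
  exists d K : R, [/\ 0 < d, 0 < K & forall y z, `|x - y| < d -> `|x - z| < d ->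
    `|f y - f z| <= K * `|y - z|].
Proof.
move=> oU fC1 Ux.
have [d d0 Hd] := C1_strict oU fC1 Ux ltr01.
have df := C1_differentiable oU fC1 Ux.
pose K := \sum_(j < m) `|'D_(delta_mx 0 j) f x|.
have K0 : 0 <= K by exact: sumr_ge0.
exists d, (1 + K); split => //; first by rewrite ltr_wpDr.
move=> y z xy xz; rewrite -[f y - f z](subrK ('D_(y - z) f x)) mulrDl.
apply: le_trans (ler_normD _ _) _; apply: lerD; first exact: Hd.
rewrite (derive_rV_sum _ df); apply: le_trans (ler_norm_sum _ _ _) _.
rewrite /K mulr_suml; apply: ler_sum => j _.
by rewrite normrZ mulrC ler_wpM2l// row_norm_le.
Qed.

(** Only a derivative of [f] in the direction [v] is at hand, so the chain rule for differentials is
    applied to [g] after the restriction of [f] to a line. *)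
Lemma is_derive_comp (E F G : normedModType R) (f : E -> F) (g : F -> G) x v w :
  is_derive x v f w -> differentiable g (f x) ->
  is_derive x v (g \o f) ('D_w g (f x)).
Proof.
move=> [df <-] dg; pose h (s : R) := f (s *: v + x).
have h0 : h 0 = f x by rewrite /h scale0r add0r.
have dh : differentiable h 0.
  by apply/derivable1_diffP/derivable_lineP; rewrite scale0r add0r.
have dgh : differentiable (g \o h) 0 by apply: differentiable_comp; rewrite ?h0.
have E1 : derivable (g \o f) x v.
  have := (derivable_lineP (g \o f) x v 0).1 ((derivable1_diffP _ _).2 dgh).
  by rewrite scale0r add0r.
split => //.
have := derive_line (g \o f) x v 0; rewrite scale0r add0r => <-.
have dg' : differentiable g (h 0) by rewrite h0.
rewrite -[fun s => _]/(g \o h) (deriveE _ dgh) (diff_comp dh dg') /=.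
rewrite -(deriveE _ dh) h0 -(deriveE _ dg).
by rewrite /h derive_line scale0r add0r.
Qed.

(** Induction on [k]: the derivative of [g \o f] along [v] is a sum of products of coordinates of
    ['D_v f] with partial derivatives of [g] composed with [f], all of which are regular to one
    order less. *)
Lemma Ck_on_comp (E : normedModType R) n k (U : set E)
    (V : set 'rV[R]_n) (f : E -> 'rV[R]_n) (g : 'rV[R]_n -> R) :
  open U -> open V -> (forall x, U x -> V (f x)) ->
  Ck_on k U f -> Ck_on k V g -> Ck_on k U (g \o f).
Proof.
move=> oU oV UV; elim: k g => [|k IH] g fk gk.
  split=> // x Ux; apply: continuous_comp.
    exact: Ck_on_continuous fk Ux.
  exact: Ck_on_continuous gk (UV _ Ux).
have gk1 : Ck_on 1 V g.
  by elim: (k) gk => [//|j IHj] /Ck_onW/IHj.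
have D x v : U x -> is_derive x v (g \o f) ('D_('D_v f x) g (f x)).
  move=> Ux; apply: is_derive_comp.
    by split => //; exact: Ck_on_derivable fk Ux.
  exact: C1_differentiable_scalar oV gk1 (UV _ Ux).
split.
  move=> x Ux; apply: continuous_comp; first exact: Ck_on_continuous fk Ux.
  exact: Ck_on_continuous gk (UV _ Ux).
split=> [x v Ux|v]; first by have [] := D x v Ux.
apply: (@Ck_on_eq _ _ _ _ _ (fun x => \sum_j ('D_v f x) 0 j *
    (('D_(delta_mx 0 j) g) \o f) x)) => //.
  move=> x Ux; have [_ ->] := D x v Ux.
  by rewrite (derive_rV_sum _ (C1_differentiable_scalar oV gk1 (UV _ Ux))).
apply: Ck_on_sum => // j; apply: Ck_onM => //.
  exact/Ck_on_coord/Ck_on_derive.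
by apply: IH; [exact: Ck_onW|exact: Ck_on_derive].
Qed.

Lemma Ck_on_comp_rV (E : normedModType R) n p k (U : set E)
    (V : set 'rV[R]_n) (f : E -> 'rV[R]_n) (g : 'rV[R]_n -> 'rV[R]_p) :
  open U -> open V -> (forall x, U x -> V (f x)) ->
  Ck_on k U f -> Ck_on k V g -> Ck_on k U (g \o f).
Proof.
move=> oU oV UV fk gk; apply: Ck_on_mx => // i j.
apply: (Ck_on_comp oU oV UV fk (g := fun x => g x i j)).
exact: Ck_on_coord.
Qed.

End C1_calculus.

(** * Symmetry of second derivatives *)

Section second_order.
Variable R : realType.

Lemma derivable_shiftP (E F : normedModType R) (f : E -> F) (a x v : E) :
  derivable (fun y => f (a + y)) x v <-> derivable f (a + x) v.
Proof.
rewrite /derivable; set g1 := fun h => h^-1 *: _; set g2 := fun h => h^-1 *: _.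
suff -> : g1 = g2 by [].
by apply/funext => h; rewrite /g1 /g2 /= addrCA.
Qed.

Lemma derive_shiftE (E F : normedModType R) (f : E -> F) (a x v : E) :
  'D_v (fun y => f (a + y)) x = 'D_v f (a + x).
Proof.
rewrite /derive; set g1 := fun h => h^-1 *: _; set g2 := fun h => h^-1 *: _.
suff -> : g1 = g2 by [].
by apply/funext => h; rewrite /g1 /g2 /= addrCA.
Qed.

Let second_difference (E : normedModType R) (f : E -> R) (x v w : E) (h : R) :=
  f (h *: w + (h *: v + x)) - f (h *: v + x) - (f (h *: w + x) - f x).

Let second_differenceC (E : normedModType R) (f : E -> R) (x v w : E) (h : R) :
  second_difference f x v w h = second_difference f x w v h.
Proof. by rewrite /second_difference addrCA; ring. Qed.

(** Two mean value theorems: along [h *: v] for the increment [f (h *: w + y) - f y], then along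
    [h *: w] for ['D_v f]. The second derivative is thus met at a point of the parallelogram, close
    to [x]. *)
Let second_difference_cvg (E : normedModType R) (U : set E) (f : E -> R)
    (x v w : E) (e : R) :
  open U -> Ck_on 2 U f -> U x -> 0 < e ->
  exists2 d : R, 0 < d & forall h, 0 < h -> h < d ->
    `|second_difference f x v w h - h ^+ 2 * 'D_w ('D_v f) x| < h ^+ 2 * e.
Proof.
move=> oU f2 Ux e0.
have cD := Ck_on_continuous (Ck_on_derive w (Ck_on_derive v f2)) Ux.
have H : \forall y \near x, U y /\ `|'D_w ('D_v f) x - 'D_w ('D_v f) y| < e.
  move/cvgrPdist_lt : cD => /(_ _ e0) H.
  exact: (filterI (open_nbhs_nbhs (conj oU Ux)) H).
have [r r0 Hr] := near_norm_ball H.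
(* Every point of the parallelogram spanned at [x] by [h *: v] and [h *: w] lies within [h * c < r]
   of [x]; the 1 keeps [c] positive. *)
pose c := `|v| + `|w| + 1.
have c0 : 0 < c by rewrite ltr_wpDl// addr_ge0.
exists (r / c); first exact: divr_gt0.
move=> h h0; rewrite ltr_pdivlMr// => hr.
have inb (s t : R) : 0 <= s <= 1 -> 0 <= t <= 1 ->
    `|x - (s *: (h *: w) + (t *: (h *: v) + x))| < r.
  move=> /andP[s0 s1] /andP[t0 t1]; rewrite addrA opprD addrCA subrr addr0 normrN.
  apply: le_lt_trans (ler_normD _ _) _; apply: le_lt_trans hr.
  rewrite !normrZ !ger0_norm ?(ltW h0)// /c.
  have A1 : s * (h * `|w|) <= h * `|w| by rewrite ler_piMl// mulr_ge0// ltW.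
  have A2 : t * (h * `|v|) <= h * `|v| by rewrite ler_piMl// mulr_ge0// ltW.
  by rewrite !mulrDr mulr1; move: A1 A2 h0; lra.
have fU y z : U y -> derivable f y z by move=> Uy; exact: (Ck_on_derivable f2 Uy).
have o01 : (0 : R) <= 1 <= (1 : R) by lra.
have z01 : (0 : R) <= 0 <= (1 : R) by lra.
pose g y := f (h *: w + y) - f y.
have d1 (t : R) : 0 <= t <= 1 ->
    derivable (fun y => f (h *: w + y)) (t *: (h *: v) + x) (h *: v).
  move=> t01; apply/derivable_shiftP; apply: fU.
  by have := Hr _ (inb 1 t o01 t01); rewrite scale1r => -[].
have d2 (t : R) : 0 <= t <= 1 -> U (t *: (h *: v) + x).
  by move=> t01; have := Hr _ (inb 0 t z01 t01); rewrite scale0r add0r => -[].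
have dg (t : R) : 0 <= t <= 1 -> derivable g (t *: (h *: v) + x) (h *: v).
  by move=> t01; apply: derivableB; [exact: d1|exact/fU/d2].
have [t t01 gE] := mvt_dir dg.
have {}gE : second_difference f x v w h =
    h * ('D_v f (h *: w + (t *: (h *: v) + x)) - 'D_v f (t *: (h *: v) + x)).
  rewrite /second_difference -/(g x) -/(g (h *: v + x)) gE /g.
  rewrite (deriveB (d1 _ t01) (fU _ _ (d2 _ t01))) derive_shiftE mulrBr.
  have Us : U (h *: w + (t *: (h *: v) + x)).
    by have := Hr _ (inb 1 t o01 t01); rewrite scale1r => -[].
  have [_ ->] := is_derive_scale h (fU _ v Us).
  by have [_ ->] := is_derive_scale h (fU _ v (d2 _ t01)).
have dD (s : R) : 0 <= s <= 1 ->
    derivable ('D_v f) (s *: (h *: w) + (t *: (h *: v) + x)) (h *: w).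
  move=> s01; apply: (Ck_on_derivable (Ck_on_derive v f2)).
  by have [] := Hr _ (inb s t s01 t01).
have [s s01 DE] := mvt_dir dD.
have [Us Hs] := Hr _ (inb s t s01 t01).
rewrite gE DE.
have [_ ->] := is_derive_scale h (Ck_on_derivable (v := w) (Ck_on_derive v f2) Us).
rewrite -[_ *: _]/(_ * _) mulrA -expr2 -mulrBr normrM ger0_norm ?exprn_ge0 ?(ltW h0)//.
have h2 : 0 < h ^+ 2 by rewrite exprn_gt0.
by rewrite (ltr_pM2l h2) distrC.
Qed.

(** One second difference, symmetric in [v] and [w], approximates [h ^+ 2] times both mixed
    derivatives. Were these distinct, two errors below half their gap would contradict the triangle
    inequality. *)
Lemma derive_comm (E : normedModType R) (U : set E) (f : E -> R) (x v w : E) :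
  open U -> Ck_on 2 U f -> U x -> 'D_v ('D_w f) x = 'D_w ('D_v f) x.
Proof.
move=> oU f2 Ux; apply/eqP; rewrite eq_sym -subr_eq0 -normr_eq0.
apply/negPn/negP => n0.
have e0 : 0 < `|'D_w ('D_v f) x - 'D_v ('D_w f) x| / 2.
  by rewrite divr_gt0// lt_neqAle eq_sym n0 /=.
have [d1 d10 H1] := second_difference_cvg v w oU f2 Ux e0.
have [d2 d20 H2] := second_difference_cvg w v oU f2 Ux e0.
pose h := Num.min d1 d2 / 2.
have m0 : 0 < Num.min d1 d2 by rewrite lt_min d10.
have h0 : 0 < h by rewrite divr_gt0.
have hm : h < Num.min d1 d2 by rewrite /h ltr_pdivrMr// ltr_pMr// ltr1n.
move: hm; rewrite lt_min => /andP[/(H1 _ h0) A1 /(H2 _ h0)].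
rewrite second_differenceC => A2.
have h2 : 0 < h ^+ 2 by rewrite exprn_gt0.
have := ler_normB (second_difference f x v w h - h ^+ 2 * 'D_v ('D_w f) x)
  (second_difference f x v w h - h ^+ 2 * 'D_w ('D_v f) x).
rewrite opprB addrC addrA subrK -mulrBr normrM (ger0_norm (ltW h2)).
move=> A3; have := le_lt_trans A3 (ltrD A2 A1).
by rewrite -mulrDr -splitr ltxx.
Qed.

Lemma derive_comm_rV (E : normedModType R) n (U : set E) (f : E -> 'rV[R]_n)
    (x v w : E) :
  open U -> Ck_on 2 U f -> U x -> 'D_v ('D_w f) x = 'D_w ('D_v f) x.
Proof.
move=> oU f2 Ux; apply/rowP => j.
have DD (a b : E) : ('D_a ('D_b f) x) 0 j = 'D_a ('D_b (fun y => f y 0 j)) x.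
  rewrite derive_coord; last exact: Ck_on_derivable (Ck_on_derive b f2) Ux.
  apply: near_eq_derive; apply: (near_open oU Ux) => y Uy.
  by rewrite derive_coord//; exact: Ck_on_derivable f2 Uy.
have C := @derive_comm E U (fun y => f y 0 j) x v w oU (Ck_on_coord 0 j oU f2) Ux.
exact: (etrans (DD v w) (etrans C (esym (DD w v)))).
Qed.

End second_order.

(** * Regularity of a continuous inverse *)

Section inverse_function.
Variable R : realType.

Lemma Ck_on_det (E : normedModType R) k (U : set E) m (A : E -> 'M[R]_m) :
  open U -> (forall i j, Ck_on k U (fun x => A x i j)) ->
  Ck_on k U (fun x => \det (A x)).
Proof.
move=> oU H; apply: Ck_on_sum => // s; apply: Ck_onM => //; first exact: Ck_on_cst.
exact: Ck_on_prod.
Qed.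

Lemma Ck_on_invmx (E : normedModType R) k (U : set E) m (A : E -> 'M[R]_m) i j :
  open U -> (forall x, U x -> A x \in unitmx) ->
  (forall i j, Ck_on k U (fun x => A x i j)) ->
  Ck_on k U (fun x => invmx (A x) i j).
Proof.
move=> oU uA H.
apply: (@Ck_on_eq _ _ _ _ _ (fun x => (\det (A x))^-1 *
    ((-1) ^+ (j + i) * \det (row' j (col' i (A x)))))) => //.
  by move=> x Ux; rewrite /invmx uA// !mxE.
apply: Ck_onM => //.
  apply: Ck_onV => //; last exact: Ck_on_det.
  by move=> x Ux; rewrite -unitfE -unitmxE uA.
apply: Ck_onM => //; first exact: Ck_on_cst.
apply: Ck_on_det => // a b.
rewrite (_ : (fun x => _) = (fun x => A x (lift j a) (lift i b)))//.
by apply/funext => x; rewrite !mxE.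
Qed.

Lemma mulmx_bound m n (A : 'M[R]_(m, n)) :
  exists2 C : R, 0 < C & forall v : 'rV[R]_m, `|v *m A| <= C * `|v|.
Proof.
exists (1 + m%:R * `|A|); first by rewrite ltr_wpDr// mulr_ge0.
move=> v; apply: row_norm_leP => [|i j]; first by rewrite mulr_ge0// addr_ge0// mulr_ge0.
rewrite ord1 mxE; apply: le_trans (ler_norm_sum _ _ _) _.
apply: (@le_trans _ _ (\sum_(k < m) `|A| * `|v|)).
  by apply: ler_sum => k _; rewrite normrM mulrC ler_pM// row_norm_le.
rewrite sumr_const card_ord -mulr_natl; have := normr_ge0 v; lra.
Qed.

Definition jacobian_mx m n (f : 'rV[R]_m -> 'rV[R]_n) (z : 'rV[R]_m)
  : 'M[R]_(m, n) := \matrix_(i, j) ('D_(delta_mx 0 i) f z) 0 j.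

Lemma jacobian_mxE m n (f : 'rV[R]_m -> 'rV[R]_n) z v :
  differentiable f z -> 'D_v f z = v *m jacobian_mx f z.
Proof.
move=> df; rewrite (derive_rV_sum _ df); apply/rowP => j.
by rewrite mxE summxE; apply: eq_bigr => i _; rewrite !mxE.
Qed.

(** Continuity of [psi] brings [psi (h + y)] to where [phi] is nearly linear. The increment [z] of
    [psi] then differs from [h *m A] by a small multiple of the norm of [z], which is absorbed to
    give a bound in terms of [h]. *)
Lemma inverse_differentiable m (W V : set 'rV[R]_m) (phi psi : 'rV[R]_m -> 'rV[R]_m)
    y :
  open W -> open V -> (forall y, V y -> W (psi y)) ->
  (forall y, V y -> phi (psi y) = y) ->
  (forall y, V y -> {for y, continuous psi}) ->
  Ck_on 1 W phi -> V y -> jacobian_mx phi (psi y) \in unitmx ->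
  differentiable psi y /\
  forall v, 'D_v psi y = v *m invmx (jacobian_mx phi (psi y)).
Proof.
move=> oW oV VW phiK cpsi phi1 Vy uJ.
set J := jacobian_mx _ _ in uJ *; set A := invmx J.
have linL : linear (fun v : 'rV[R]_m => v *m A).
  by move=> c u v; rewrite mulmxDl -scalemxAl.
pose LM := GRing.isLinear.Build _ _ _ _ _ linL.
pose L : {linear 'rV[R]_m -> 'rV[R]_m} := HB.pack (fun v : 'rV[R]_m => v *m A) LM.
have [C C0 HC] := mulmx_bound A.
have cL : continuous L.
  apply/linear_bounded_continuous/bounded_funP => r; exists (C * r) => v vr.
  by apply: le_trans (HC v) _; rewrite ler_pM2l.
have small (e : R) : 0 < e ->
    \forall h \near (0 : 'rV[R]_m), `|psi (h + y) - psi y - h *m A| <= e * `|h|.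
  move=> e0.
  (* The first bound gives [C * e1 <= 1/2], whence the increment of [psi] is at most [2 * C] times
     that of [y]; the second turns the resulting error into at most [e] times the norm of [h]. *)
  pose e1 := Num.min (2 * C)^-1 (e / (2 * C ^+ 2)).
  have e10 : 0 < e1.
    by rewrite lt_min invr_gt0 mulr_gt0// divr_gt0// mulr_gt0// exprn_gt0.
  have dphi := C1_differentiable oW phi1 (VW _ Vy).
  have [d d0 Hd] := C1_strict oW phi1 (VW _ Vy) e10.
  have near1 : \forall y' \near y, V y' /\ `|psi y - psi y'| < d.
    have /cvgrPdist_lt/(_ _ d0) H := cpsi _ Vy.
    exact: (filterI (open_nbhs_nbhs (conj oV Vy)) H).
  have [r r0 Hr] := near_norm_ball near1.
  apply/nbhs_normP; exists r => // h; rewrite /= sub0r normrN => hr.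
  have [Vh psih] : V (h + y) /\ `|psi y - psi (h + y)| < d.
    by apply: Hr; rewrite opprD addrCA subrr addr0 normrN.
  have := Hd _ (psi y) psih; rewrite subrr normr0 => /(_ d0).
  rewrite !phiK// addrK jacobian_mxE// -/J.
  set z := psi (h + y) - psi y => B1.
  have B2 : `|z - h *m A| <= C * (e1 * `|z|).
    rewrite -[z](mulmxK uJ) -/A -mulmxBl; apply: le_trans (HC _) _.
    by rewrite ler_pM2l// distrC mulmxK.
  have B3 : `|z| <= 2 * C * `|h|.
    have B4 : `|z| <= `|z - h *m A| + `|h *m A|.
      by rewrite -[z in leLHS](subrK (h *m A)) ler_normD.
    have B5 : C * e1 * `|z| <= 2^-1 * `|z|.
      apply: ler_wpM2r => //; rewrite mulrC -ler_pdivlMr//.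
      by rewrite -invfM ge_min lexx.
    have := HC h; move: B2; rewrite mulrA; move: B4 B5; lra.
  apply: le_trans B2 _.
  have B6 : e1 * (2 * C ^+ 2) <= e.
    by rewrite -ler_pdivlMr ?mulr_gt0 ?exprn_gt0// ge_min lexx orbT.
  apply: le_trans (_ : _ <= C * (e1 * (2 * C * `|h|))) _.
    by rewrite !ler_pM2l.
  rewrite (_ : C * _ = e1 * (2 * C ^+ 2) * `|h|); last by ring.
  by apply: ler_wpM2r.
exact: (@diff_of_small _ _ _ psi y L cL small).
Qed.

(** Bootstrap: ['D_v psi] is the function [v *m invmx (jacobian_mx phi z)] evaluated at [z = psi y],
    so that each order of regularity of [psi] gives the next one. *)
Lemma inverse_smooth m (W V : set 'rV[R]_m) (phi psi : 'rV[R]_m -> 'rV[R]_m) :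
  open W -> open V -> (forall y, V y -> W (psi y)) ->
  (forall y, V y -> phi (psi y) = y) ->
  (forall y, V y -> {for y, continuous psi}) ->
  smooth_on W phi ->
  (forall z, W z -> jacobian_mx phi z \in unitmx) -> smooth_on V psi.
Proof.
move=> oW oV VW phiK cpsi sphi uJ.
have D y : V y -> differentiable psi y /\
    forall v, 'D_v psi y = v *m invmx (jacobian_mx phi (psi y)).
  by move=> Vy; apply: (inverse_differentiable oW oV VW phiK cpsi) => //; exact/uJ/VW.
elim=> [|k IH]; first by split.
split=> //; split=> [y v Vy|v].
  by apply: diff_derivable; have [] := D y Vy.
pose G (z : 'rV[R]_m) : 'rV[R]_m := v *m invmx (jacobian_mx phi z).
apply: (@Ck_on_eq _ _ _ _ _ (G \o psi)) => //.
  by move=> y Vy; have [_ ->] := D y Vy.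
apply: (Ck_on_comp_rV oV oW VW IH).
apply: Ck_on_mx => // i j.
rewrite (_ : (fun x => _) = fun x => \sum_l v i l * invmx (jacobian_mx phi x) l j);
  last by apply/funext => x; rewrite mxE.
apply: Ck_on_sum => // l; apply: Ck_onM => //; first exact: Ck_on_cst.
apply: Ck_on_invmx => // a b.
rewrite (_ : (fun x => _) = fun x => ('D_(delta_mx 0 a) phi x) 0 b);
  last by apply/funext => x; rewrite mxE.
exact: Ck_on_coord (Ck_on_derive _ (sphi k.+1)).
Qed.

End inverse_function.

(** * Charts and tangent maps *)

Section charts.
Variables (R : realType).

Section one_manifold.
Variables (n : nat) (M : smooth_manifold R n).
Implicit Types (i j k : chart_index M) (x : M).

Lemma chart_image i x : chart_dom i x -> (chart i @` chart_dom i) (chart i x).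
Proof. by exists x. Qed.

Lemma chart_inv_dom i y : (chart i @` chart_dom i) y -> chart_dom i (chart_inv i y).
Proof. by move=> [x dx <-]; rewrite chartK. Qed.

Lemma chart_invK i y : (chart i @` chart_dom i) y -> chart i (chart_inv i y) = y.
Proof. by move=> [x dx <-]; rewrite chartK. Qed.

Lemma near_chart_inv i x (O : set M) :
  chart_dom i x -> open O -> O x ->
  \forall y \near chart i x, (chart i @` chart_dom i) y /\ O (chart_inv i y).
Proof.
move=> dx oO Ox.
have H1 : nbhs (chart i x) (chart i @` chart_dom i).
  by apply: open_nbhs_nbhs; split; [exact: chart_image_open|exact: chart_image].
have H2 : nbhs (chart i x) (chart_inv i @^-1` O).
  apply: (chart_inv_continuous (chart_image dx)); rewrite chartK//.
  exact: open_nbhs_nbhs.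
exact: (filterI H1 H2).
Qed.

Lemma chart_image_openI i (O : set M) :
  open O -> open (chart i @` (chart_dom i `&` O)).
Proof.
move=> oO; rewrite openE => _ [x [dx Ox] <-].
apply: filterS (near_chart_inv dx oO Ox) => y [yi Oy].
by exists (chart_inv i y); [split => //; exact: chart_inv_dom|exact: chart_invK].
Qed.

End one_manifold.

Definition local_rep m n (M : smooth_manifold R m) (N : smooth_manifold R n)
  (f : M -> N) (i : chart_index M) (j : chart_index N) := chart j \o f \o chart_inv i.

(** Transition maps are the local representations of the identity, so coordinate changes inherit the
    lemmas on [local_rep]. *)
Lemma smooth_id n (M : smooth_manifold R n) : smooth_map (fun x : M => x).
Proof. by split; [move=> x; exact: cvg_id|exact: transition_smooth]. Qed.

Lemma local_rep_dom_open m n (M : smooth_manifold R m) (N : smooth_manifold R n)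
    (f : M -> N) i j :
  continuous f -> open (chart i @` (chart_dom i `&` f @^-1` chart_dom j)).
Proof.
move=> cf; apply: chart_image_openI; apply: open_comp => [x _|]; first exact: cf.
exact: chart_dom_open.
Qed.

Lemma local_rep_differentiable m n (M : smooth_manifold R m)
    (N : smooth_manifold R n) (f : M -> N) i j x :
  smooth_map f -> chart_dom i x -> chart_dom j (f x) ->
  differentiable (local_rep f i j) (chart i x).
Proof.
move=> [cf sf] dx dfx.
by apply: (C1_differentiable (local_rep_dom_open (i := i) (j := j) cf) (sf i j 1%N));
  exists x.
Qed.

(** The parameter space [E] is arbitrary so that [c] can be a curve as well as an inverse chart
    followed by a map. *)
Lemma is_derive_chart (E : normedModType R) m n (M : smooth_manifold R m)
    (N : smooth_manifold R n) (f : M -> N) (c : E -> M) i j e v w :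
  smooth_map f -> {for e, continuous c} ->
  chart_dom i (c e) -> chart_dom j (f (c e)) ->
  is_derive e v (chart i \o c) w ->
  is_derive e v (chart j \o f \o c) ('D_w (local_rep f i j) (chart i (c e))).
Proof.
move=> sf cc dc dfc dw.
have := is_derive_comp dw (local_rep_differentiable sf dc dfc).
apply: near_eq_is_derive.
have : nbhs e (c @^-1` chart_dom i).
  by apply: cc; apply: open_nbhs_nbhs; split=> //; exact: chart_dom_open.
by apply: filterS => e' de'; rewrite /local_rep /= chartK.
Qed.

Lemma derive_local_rep_comp m n p (M : smooth_manifold R m)
    (N : smooth_manifold R n) (P : smooth_manifold R p) (f : M -> N) (g : N -> P)
    i j k x v :
  smooth_map f -> smooth_map g ->
  chart_dom i x -> chart_dom j (f x) -> chart_dom k (g (f x)) ->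
  'D_v (local_rep (g \o f) i k) (chart i x) =
  'D_('D_v (local_rep f i j) (chart i x)) (local_rep g j k) (chart j (f x)).
Proof.
move=> sf sg dx dfx dgfx.
pose c := f \o chart_inv i.
have cc : {for chart i x, continuous c}.
  apply: continuous_comp; first exact: chart_inv_continuous (chart_image dx).
  by case: sf => + _; exact.
have df : is_derive (chart i x) v (chart j \o c) ('D_v (local_rep f i j) (chart i x)).
  split=> //; apply: diff_derivable; exact: local_rep_differentiable.
have ce : c (chart i x) = f x by rewrite /c /= chartK.
have dc : chart_dom j (c (chart i x)) by rewrite ce.
have dgc : chart_dom k (g (c (chart i x))) by rewrite ce.
have [_] := is_derive_chart sg cc dc dgc df.
by rewrite ce.
Qed.

Section coord_change.
Variables (n : nat) (M : smooth_manifold R n).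
Implicit Types (i j k : chart_index M) (x : M).

Lemma coord_change_differentiable i j x :
  chart_dom i x -> chart_dom j x ->
  differentiable (chart j \o chart_inv i) (chart i x).
Proof. exact: (local_rep_differentiable (@smooth_id n M)). Qed.

Lemma coord_change_comp i j k x v :
  chart_dom i x -> chart_dom j x -> chart_dom k x ->
  coord_change j k x (coord_change i j x v) = coord_change i k x v.
Proof.
move=> di dj dk.
by rewrite /coord_change -(derive_local_rep_comp v (smooth_id M) (smooth_id M) di dj dk).
Qed.

Lemma coord_change_id i x v : chart_dom i x -> coord_change i i x v = v.
Proof.
move=> di; rewrite /coord_change -[RHS](derive_id (chart i x)).
apply: near_eq_derive; apply: filterS (near_chart_inv di openT I) => y [yi _].
exact: chart_invK.
Qed.

Lemma coord_changeE i j x v : chart_dom i x -> chart_dom j x ->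
  coord_change i j x v = v *m jacobian_mx (chart j \o chart_inv i) (chart i x).
Proof.
move=> di dj; rewrite /coord_change jacobian_mxE//.
exact: coord_change_differentiable.
Qed.

Lemma coord_change_inj i j x v : chart_dom i x -> chart_dom j x ->
  coord_change i j x v = 0 -> v = 0.
Proof.
move=> di dj H; rewrite -[v](coord_change_id v di) -(coord_change_comp v di dj di) H.
by rewrite coord_changeE// mul0mx.
Qed.

End coord_change.

Lemma derive_local_repE m n (M : smooth_manifold R m)
    (N : smooth_manifold R n) (f : M -> N) i j x v :
  smooth_map f -> chart_dom i x -> chart_dom j (f x) ->
  'D_v (local_rep f i j) (chart i x) =
  coord_change (chart_at (f x)) j (f x)
    (tangent_map f x (coord_change i (chart_at x) x v)).
Proof.
move=> sf di dj; have dx := chart_atP x; have dfx := chart_atP (f x).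
rewrite /tangent_map -/(local_rep _ _ _) /coord_change.
rewrite -(derive_local_rep_comp v (smooth_id M) sf di dx dfx).
by rewrite -(derive_local_rep_comp v sf (smooth_id N) di dfx dj).
Qed.

Lemma tangent_map_comp m n p (M : smooth_manifold R m)
    (N : smooth_manifold R n) (P : smooth_manifold R p) (f : M -> N) (g : N -> P)
    x v : smooth_map f -> smooth_map g ->
  tangent_map (g \o f) x v = tangent_map g (f x) (tangent_map f x v).
Proof.
move=> sf sg.
exact: (derive_local_rep_comp v sf sg (chart_atP x) (chart_atP _) (chart_atP _)).
Qed.

Lemma smooth_map_comp m n p (M : smooth_manifold R m)
    (N : smooth_manifold R n) (P : smooth_manifold R p) (f : M -> N) (g : N -> P) :
  smooth_map f -> smooth_map g -> smooth_map (g \o f).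
Proof.
move=> sf sg; have [cf sf'] := sf; have [cg sg'] := sg.
split=> [x|i k d]; first by apply: continuous_comp; [exact: cf|exact: cg].
apply: Ck_on_local => _ [x [dx dgfx] <-].
pose j := chart_at (f x).
pose O := f @^-1` (chart_dom j `&` g @^-1` chart_dom k).
have oO : open O.
  apply: open_comp => [? _|]; first exact: cf.
  apply: openI; first exact: chart_dom_open.
  by apply: open_comp => [? _|]; [exact: cg|exact: chart_dom_open].
have oU := chart_image_openI (i := i) oO.
exists (chart i @` (chart_dom i `&` O)).
  by exists x => //; split => //; split; [exact: chart_atP|].
apply: (@Ck_on_eq _ _ _ _ _ (local_rep g j k \o local_rep f i j)) => //.
  by move=> _ [y [dy [djy _]] <-]; rewrite /local_rep /= chartK// chartK.
apply: (@Ck_on_comp_rV _ _ _ _ d _ (chart j @` (chart_dom j `&` g @^-1` chart_dom k)))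
    => //.
- exact: local_rep_dom_open.
- by move=> _ [y [dy Oy] <-]; exists (f y) => //; rewrite /local_rep /= chartK.
- apply: Ck_on_sub (sf' i j d) => _ [y [dy [djy _]] <-].
  by exists y.
- exact: sg'.
Qed.

Lemma gram_localE m (M : metric_manifold R m) (i : chart_index M) x v w : chart_dom i x ->
  gram_local (@gram R m M) i v w (chart i x) =
  inner x (coord_change i (chart_at x) x v) (coord_change i (chart_at x) x w).
Proof. by move=> di; rewrite /gram_local chartK. Qed.

Section metric.
Variables (m n : nat) (M : metric_manifold R m) (N : metric_manifold R n).

Lemma gram_local_isometry (f : M -> N) i j x v w :
  smooth_map f -> preserves_metric f -> chart_dom i x -> chart_dom j (f x) ->
  gram_local (@gram R n N) j ('D_v (local_rep f i j) (chart i x))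
    ('D_w (local_rep f i j) (chart i x)) (chart j (f x)) =
  gram_local (@gram R m M) i v w (chart i x).
Proof.
move=> sf pf di dj; have dfx := chart_atP (f x).
rewrite (gram_localE _ _ dj) (gram_localE _ _ di).
rewrite (derive_local_repE v sf di dj) (derive_local_repE w sf di dj).
have K u : coord_change j (chart_at (f x)) (f x) (coord_change (chart_at (f x)) j (f x) u) = u.
  exact: etrans (coord_change_comp u dfx dj dfx) (coord_change_id u dfx).
pose T u := tangent_map f x (coord_change i (chart_at x) x u).
exact (etrans (f_equal2 (inner (f x)) (K (T v)) (K (T w))) (pf x _ _)).
Qed.

(** Bilinearity reduces vectors that vary with the point to the basis vectors, for which
    [gram_smooth] provides smooth coefficients. *)
Lemma gram_local_sum (i : chart_index M) (v w y : 'rV[R]_m) :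
  (chart i @` chart_dom i) y ->
  gram_local (@gram R m M) i v w y = \sum_a \sum_b
    v 0 a * w 0 b * gram_local (@gram R m M) i (delta_mx 0 a) (delta_mx 0 b) y.
Proof.
move=> [x dx <-]; rewrite gram_localE//.
pose J := jacobian_mx (chart (chart_at x) \o chart_inv i) (chart i x).
have E u u' : inner x (coord_change i (chart_at x) x u)
    (coord_change i (chart_at x) x u') = (u *m (J *m gram x *m J^T) *m u'^T) 0 0.
  rewrite !coord_changeE//; try exact: chart_atP.
  by rewrite /inner /gram_inner trmx_mul !mulmxA.
rewrite E.
under eq_bigr => a _ do under eq_bigr => b _ do rewrite (gram_localE _ _ dx) E.
set G := J *m _ *m _.
have GE a b : ((delta_mx 0 a : 'rV[R]_m) *m G *m (delta_mx 0 b : 'rV[R]_m)^T) 0 0 = G a b.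
  by rewrite trmx_delta -rowE -colE !mxE.
under eq_bigr do under eq_bigr do rewrite GE.
rewrite mxE exchange_big /=; apply: eq_bigr => b _.
rewrite mxE mulr_suml; apply: eq_bigr => a _; rewrite !mxE.
by rewrite mulrAC.
Qed.

Lemma gram_local_gt0 (i : chart_index M) x v : chart_dom i x -> v != 0 ->
  0 < gram_local (@gram R m M) i v v (chart i x).
Proof.
move=> di v0; rewrite gram_localE//; apply: gram_pos.
apply: contra_neq v0; apply: coord_change_inj => //; exact: chart_atP.
Qed.

End metric.

Lemma preserves_metric_comp m n p (M : metric_manifold R m)
    (N : metric_manifold R n) (P : metric_manifold R p) (f : M -> N) (g : N -> P) :
  smooth_map f -> smooth_map g -> preserves_metric f -> preserves_metric g ->
  preserves_metric (g \o f).
Proof.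
move=> sf sg pf pg x v w.
by rewrite (tangent_map_comp x v sf sg) (tangent_map_comp x w sf sg) pg pf.
Qed.

Lemma local_isometry_comp n (M N P : metric_manifold R n) (f : M -> N) (g : N -> P) :
  local_isometry f -> local_isometry g -> local_isometry (g \o f).
Proof.
move=> [sf pf] [sg pg]; split; first exact: smooth_map_comp.
exact: preserves_metric_comp.
Qed.

End charts.

(** * One-parameter families of maps *)

Lemma continuous_pair (T T1 T2 : topologicalType) (f : T -> T1) (g : T -> T2) x :
  {for x, continuous f} -> {for x, continuous g} ->
  {for x, continuous (fun x => (f x, g x))}.
Proof. by move=> cf cg; exact: (cvg_pair cf cg). Qed.

Lemma continuous_pair2 (T1 T2 T : topologicalType) (G : T1 * T2 -> T) t z :
  {for (t, z), continuous G} -> {for z, continuous (fun z => G (t, z))}.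
Proof.
move=> cG; apply: (@continuous_comp _ _ _ (fun z => (t, z)) G z _ cG).
by apply: continuous_pair; [exact: cst_continuous|exact: cvg_id].
Qed.

Lemma continuous_pair1 (T1 T2 T : topologicalType) (G : T1 * T2 -> T) t z :
  {for (t, z), continuous G} -> {for t, continuous (fun t => G (t, z))}.
Proof.
move=> cG; apply: (@continuous_comp _ _ _ (fun t => (t, z)) G t _ cG).
by apply: continuous_pair; [exact: cvg_id|exact: cst_continuous].
Qed.

Section partial_derivatives.
Variables (R : realType) (E F : normedModType R).
Implicit Types (G : R * E -> F) (t : R) (z v : E).

Lemma derivable_pair1 G t z :
  derivable (fun s => G (s, z)) t 1 <-> derivable G (t, z) (1, 0).
Proof.
rewrite /derivable; set g1 := fun h => h^-1 *: _; set g2 := fun h => h^-1 *: _.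
suff -> : g1 = g2 by [].
apply/funext => h; rewrite /g1 /g2 /=.
by rewrite -[h *: (1, 0) + (t, z)]/(h *: 1 + t, h *: 0 + z) scaler0 add0r.
Qed.

Lemma derive_pair1 G t z : 'D_1 (fun s => G (s, z)) t = 'D_(1, 0) G (t, z).
Proof.
rewrite /derive; set g1 := fun h => h^-1 *: _; set g2 := fun h => h^-1 *: _.
suff -> : g1 = g2 by [].
apply/funext => h; rewrite /g1 /g2 /=.
by rewrite -[h *: (1, 0) + (t, z)]/(h *: 1 + t, h *: 0 + z) scaler0 add0r.
Qed.

Lemma derivable_pair2 G t z v :
  derivable (fun z => G (t, z)) z v <-> derivable G (t, z) (0, v).
Proof.
rewrite /derivable; set g1 := fun h => h^-1 *: _; set g2 := fun h => h^-1 *: _.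
suff -> : g1 = g2 by [].
apply/funext => h; rewrite /g1 /g2 /=.
by rewrite -[h *: (0, v) + (t, z)]/(h *: 0 + t, h *: v + z) scaler0 add0r.
Qed.

Lemma derive_pair2 G t z v : 'D_v (fun z => G (t, z)) z = 'D_(0, v) G (t, z).
Proof.
rewrite /derive; set g1 := fun h => h^-1 *: _; set g2 := fun h => h^-1 *: _.
suff -> : g1 = g2 by [].
apply/funext => h; rewrite /g1 /g2 /=.
by rewrite -[h *: (0, v) + (t, z)]/(h *: 0 + t, h *: v + z) scaler0 add0r.
Qed.

Lemma Ck_on_slice2 k (U : set (R * E)) G t :
  Ck_on k U G -> Ck_on k [set z | U (t, z)] (fun z => G (t, z)).
Proof.
elim: k G => [|k IH] G H.
  by split=> // z Uz; apply: continuous_pair2; exact: Ck_on_continuous H Uz.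
split; first by move=> z Uz; apply: continuous_pair2; exact: Ck_on_continuous H Uz.
split=> [z v Uz|v]; first by apply/derivable_pair2; exact: Ck_on_derivable H Uz.
have -> : 'D_v (fun z => G (t, z)) = (fun z => 'D_(0, v) G (t, z)).
  by apply/funext => z; exact: derive_pair2.
by apply: (IH ('D_(0, v) G)); exact: Ck_on_derive.
Qed.

Lemma Ck_on_slice1 k (U : set (R * E)) G z :
  Ck_on k U G -> Ck_on k [set t | U (t, z)] (fun t => G (t, z)).
Proof.
elim: k G => [|k IH] G H.
  by split=> // t Ut; apply: continuous_pair1; exact: Ck_on_continuous H Ut.
split; first by move=> t Ut; apply: continuous_pair1; exact: Ck_on_continuous H Ut.
have pairs (t v h : R) :
  h *: (v, 0 : E) + (t, z) = (h *: v + t, z).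
  by rewrite -[LHS]/(h *: v + t, h *: 0 + z) scaler0 add0r.
split=> [t v Ut|v].
  have := Ck_on_derivable (v := (v, 0)) H Ut.
  rewrite /derivable; set g1 := fun h => h^-1 *: _; set g2 := fun h => h^-1 *: _.
  suff -> : g1 = g2 by [].
  by apply/funext => h; rewrite /g1 /g2 /= pairs.
have -> : 'D_v (fun t => G (t, z)) = (fun t => 'D_(v, 0) G (t, z)).
  apply/funext => t.
  rewrite /derive; set g1 := fun h => h^-1 *: _; set g2 := fun h => h^-1 *: _.
  suff -> : g1 = g2 by [].
  by apply/funext => h; rewrite /g1 /g2 /= pairs.
by apply: (IH ('D_(v, 0) G)); exact: Ck_on_derive.
Qed.

End partial_derivatives.

Section family.
Variables (R : realType) (m : nat) (M : smooth_manifold R m) (a : R -> M -> M).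
Hypothesis sa : smooth_family a.

Lemma family_dom_open (i : chart_index M) (O : set M) : open O ->
  open [set z : R * 'rV[R]_m |
    exists x, [/\ chart_dom i x, chart i x = z.2 & O (a z.1 x)]].
Proof.
move=> oO; rewrite openE => -[t0 _] [x /= [dx <- Ox]].
pose g (z : R * 'rV[R]_m) : R * M := (z.1, chart_inv i z.2).
have cg : {for (t0, chart i x), continuous g}.
  apply: continuous_pair; first exact: cvg_fst.
  apply: (@continuous_comp _ _ _ (@snd R 'rV[R]_m) (chart_inv i)); first exact: cvg_snd.
  exact: chart_inv_continuous (chart_image dx).
have cag : {for (t0, chart i x), continuous (fun z => a (g z).1 (g z).2)}.
  by apply: (@continuous_comp _ _ _ g (fun z : R * M => a z.1 z.2)) => //; case: sa => + _; exact.
have H1 : nbhs (t0, chart i x) [set z | O (a (g z).1 (g z).2)].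
  by apply: cag; rewrite /g /= chartK//; exact: open_nbhs_nbhs.
have H2 : nbhs (t0, chart i x) [set z : R * 'rV[R]_m | (chart i @` chart_dom i) z.2].
  apply: (@cvg_snd _ _ (nbhs t0) (nbhs (chart i x))).
  by apply: open_nbhs_nbhs; split; [exact: chart_image_open|exact: chart_image].
apply: filterS (filterI H1 H2) => z [Oz [x' dx' xz]].
exists x'; split=> //; move: Oz; rewrite /g /= -xz chartK//.
Qed.

Variables (n : nat) (N : smooth_manifold R n) (q : M -> N).
Hypothesis sq : smooth_map q.

Definition family_dom (i : chart_index M) (j : chart_index N) :=
  [set z : R * 'rV[R]_m |
    exists x, [/\ chart_dom i x, chart i x = z.2 & chart_dom j (q (a z.1 x))]].

Definition family_rep (i : chart_index M) (j : chart_index N)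
  (z : R * 'rV[R]_m) := chart j (q (a z.1 (chart_inv i z.2))).

Let oq (j : chart_index N) : open (q @^-1` chart_dom j).
Proof.
by case: sq => cq _; apply: open_comp => [x _|]; [exact: cq|exact: chart_dom_open].
Qed.

Lemma family_dom_open_rep i j : open (family_dom i j).
Proof. exact: family_dom_open (oq j). Qed.

Lemma family_rep_smooth i j : smooth_on (family_dom i j) (family_rep i j).
Proof.
move=> d; apply: Ck_on_local => -[t0 _] [x [/= dx <- dqx]].
pose k := chart_at (a t0 x); pose O := chart_dom k `&` q @^-1` chart_dom j.
have oO : open O by apply: openI; [exact: chart_dom_open|exact: oq].
exists [set z : R * 'rV[R]_m |
    exists x, [/\ chart_dom i x, chart i x = z.2 & O (a z.1 x)]].
  by exists x; split => //; split => //; exact: chart_atP.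
have oU := @family_dom_open i _ oO.
apply: (@Ck_on_eq _ _ _ _ _ (local_rep q k j \o
    fun z : R * 'rV[R]_m => chart k (a z.1 (chart_inv i z.2)))) => //.
  move=> [t y] [x' [/= dx' <- [dk _]]]; rewrite /family_rep /local_rep /= chartK//.
  by rewrite chartK.
apply: (@Ck_on_comp_rV _ _ _ _ d _ (chart k @` O)) => //.
- exact: chart_image_openI (oq j).
- by move=> [t y] [x' [/= dx' <- Ox']]; exists (a t x') => //; rewrite chartK.
- by case: sa => _ /(_ i k d); apply: Ck_on_sub => z [x' [? ? []]]; exists x'.
- by case: sq => _ /(_ k j d).
Qed.

End family.

Section flow.
Variables (R : realType) (n : nat) (N : smooth_manifold R n) (b : R -> N -> N).
Hypothesis b0 : forall y, b 0 y = y.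
Hypothesis bD : forall s t y, b (s + t) y = b s (b t y).
Hypothesis b_cont : forall y, continuous (b^~ y).
Hypothesis b_der : forall y i, chart_dom i y ->
  derivable (fun t => chart i (b t y)) 0 1.

Definition flow_field (y : N) : 'rV[R]_n :=
  'D_1 (fun t => chart (chart_at y) (b t y)) 0.

(** The group law identifies the difference quotients at time [t] from [y] with those at time 0 from
    [b t y], so derivability at time 0 spreads to all times. *)
Lemma flow_is_derive i t y : chart_dom i (b t y) ->
  is_derive t 1 (fun s => chart i (b s y)) ('D_1 (fun s => chart i (b s (b t y))) 0).
Proof.
move=> di; have := b_der di.
move=> db.
have E : (fun h => h^-1 *: (((fun s => chart i (b s y)) \o shift t) (h *: 1) -
     chart i (b t y))) =
   (fun h => h^-1 *: (((fun s => chart i (b s (b t y))) \o shift 0) (h *: 1) -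
     chart i (b 0 (b t y)))).
  by apply/funext => h /=; rewrite addr0 bD b0.
by split; move: db; rewrite /derivable /derive E.
Qed.

Lemma flow_field_chart i y : chart_dom i y ->
  coord_change (chart_at y) i y (flow_field y) = 'D_1 (fun t => chart i (b t y)) 0.
Proof.
move=> di; have dy := chart_atP y.
have d0 : is_derive (0 : R) (1 : R) (chart (chart_at y) \o b^~ y) (flow_field y).
  by split=> //; exact: b_der.
have c0 : {for (0 : R), continuous (b^~ y)} by exact: b_cont.
have db0 j : chart_dom j y -> chart_dom j (b 0 y) by rewrite b0.
have [_] := is_derive_chart (smooth_id N) c0 (db0 _ dy) (db0 _ di) d0.
by rewrite b0.
Qed.

Lemma flow_local_field i y : (chart i @` chart_dom i) y ->
  local_field flow_field i y = 'D_1 (fun t => chart i (b t (chart_inv i y))) 0.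
Proof. by move=> iy; rewrite /local_field flow_field_chart//; exact: chart_inv_dom. Qed.

Lemma flow_integral_curve y : integral_curve flow_field (b^~ y).
Proof.
split; first exact: b_cont.
move=> t; have := flow_is_derive (chart_atP (b t y)).
by rewrite -flow_field_chart ?coord_change_id//; exact: chart_atP.
Qed.

End flow.

(** * Quotients by finite groups *)

(* The corresponding lemmas of the library require the space to be finite. *)
Section total_action.
Variables (gT : finGroupType) (T : Type) (to : {action gT &-> T}).

Lemma actM_type x g h : to x (g * h)%g = to (to x g) h.
Proof. by case: to => /= to' [_ toM]; exact: toM. Qed.

Lemma act1_type x : to x 1%g = x.
Proof.
by case: to => /= to' [inj toM]; apply: (inj 1%g); rewrite -toM ?inE// mulg1.
Qed.

Lemma act_free_inj x g h : free_action to -> to x g = to x h -> g = h.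
Proof.
move=> fr E; apply/(mulIg h^-1)%g; rewrite mulgV; apply: (fr x).
by rewrite actM_type E -actM_type mulgV act1_type.
Qed.

End total_action.

Section quotient_topology.
Variables (M N : topologicalType) (gT : finGroupType) (to : {action gT &-> M}).
Variable q : M -> N.
Hypothesis to_cont : forall g, continuous (to^~ g).
Hypothesis q_cont : continuous q.
Hypothesis q_orbits : orbit_projection to q.

(** [N] is not given as a topological quotient. Compactness of [M] makes [q] a closed map, and the
    image of [O] is the complement of the image of the complement of its saturation [S]. *)
Lemma orbit_projection_open : compact [set: M] -> hausdorff_space N ->
  forall O : set M, open O -> open (q @` O).
Proof.
move=> cM hN O oO; have [q_surj qE] := q_orbits.
pose S := \bigcup_(g in [set: gT]) (to^~ g @^-1` O).
have oS : open S.
  by apply: bigcup_open => g _; apply: open_comp => // x _; exact: to_cont.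
have cS : compact (~` S) by apply: (subclosed_compact _ cM) => //; exact: open_closedC.
have : closed (q @` ~` S).
  apply: compact_closed => //; apply: continuous_compact => //.
  by apply: continuous_subspaceT; exact: q_cont.
rewrite -openC; suff -> : ~` (q @` ~` S) = q @` O by [].
apply/seteqP; split => [y nSy|_ [x Ox <-] [x' nSx' /qE[g xg]]].
  have [x qx] := q_surj y.
  have [g _ Og] : S x by apply: contrapT => nSx; apply: nSy; exists x.
  exists (to x g) => //; rewrite -qx; apply/esym/qE; by exists g.
by apply: nSx'; exists g => //=; rewrite -xg.
Qed.

(** Freeness and the Hausdorff property separate [x] from each [to x g] with [g <> 1]; as the group
    is finite, a common neighborhood remains that contains no two points of one orbit. *)
Lemma orbit_projection_locally_injective (to_free : free_action to) x :
  hausdorff_space M ->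
  exists O : set M, [/\ open O, O x &
    forall x1 x2, O x1 -> O x2 -> q x1 = q x2 -> x1 = x2].
Proof.
move=> hM; have [_ qE] := q_orbits.
have H g : exists V : set M, nbhs x V /\
    (g <> 1%g -> forall x1 x2, V x1 -> V x2 -> x2 <> to x1 g).
  have [->|g1] := eqVneq g 1%g; first by exists setT; split => //; exact: filterT.
  have xg : x != to x g.
    by apply/eqP => /esym/to_free g1'; rewrite g1' eqxx in g1.
  move: hM; rewrite open_hausdorff => /(_ _ _ xg)[[A B] /= [/[!inE] Ax Bx] [oA oB AB]].
  exists (A `&` to^~ g @^-1` B); split.
    apply: filterI; first exact: open_nbhs_nbhs.
    by apply: to_cont; exact: open_nbhs_nbhs.
  move=> _ x1 x2 [_ /= Bx1] [Ax2 _] E.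
  have : (A `&` B) x2 by split => //; rewrite E.
  by rewrite AB.
have [V HV] := choice H.
have nV : \forall y \near x, forall g, V g y by apply: near_forall => g; exact: (HV g).1.
exists (interior [set y | forall g, V g y]); split; first exact: open_interior.
  exact: nV.
move=> x1 x2 /interior_subset V1 /interior_subset V2 /qE[g x2E].
have [g1|g1] := pselect (g = 1%g); first by rewrite x2E g1; exact/esym/act1_type.
by have := (HV g).2 g1 _ _ (V1 g) (V2 g).
Qed.

End quotient_topology.

(** * Smooth local sections of the quotient map *)

Section local_section.
Variables (R : realType) (m : nat) (M N : metric_manifold R m) (q : M -> N).
Hypothesis q_smooth : smooth_map q.
Hypothesis q_metric : preserves_metric q.
Hypothesis q_open : forall O : set M, open O -> open (q @` O).
Hypothesis q_inj : forall x, exists O : set M, [/\ open O, O x &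
    forall x1 x2, O x1 -> O x2 -> q x1 = q x2 -> x1 = x2].

(** A vector killed by a metric-preserving differential has length 0, so the differential is
    injective; equal dimensions make it invertible. *)
Lemma local_rep_unit k i x : chart_dom k x -> chart_dom i (q x) ->
  jacobian_mx (local_rep q k i) (chart k x) \in unitmx.
Proof.
move=> dk di; rewrite -row_free_unit; apply: inj_row_free => v.
rewrite -jacobian_mxE; last exact: local_rep_differentiable.
move=> Dv0; apply/eqP; apply: contraT => v0.
have := gram_local_gt0 dk v0.
rewrite -(gram_local_isometry v v q_smooth q_metric dk di) Dv0 gram_localE//.
by rewrite coord_changeE ?mul0mx ?/inner ?/gram_inner ?mul0mx ?mxE ?ltxx//; exact: chart_atP.
Qed.

(** [psi] is a section of [q] read in charts: well defined by local injectivity of [q], continuous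
    because [q] is open, and smooth because the differential of [q] is invertible. *)
Lemma local_section k i x : chart_dom k x -> chart_dom i (q x) ->
  exists (W V : set 'rV[R]_m) (psi : 'rV[R]_m -> 'rV[R]_m),
    [/\ open W, open V, W (chart k x) & smooth_on V psi] /\
    [/\ W `<=` chart k @` (chart_dom k `&` q @^-1` chart_dom i),
        forall z, W z -> V (local_rep q k i z),
        forall z, W z -> psi (local_rep q k i z) = z,
        forall y, V y -> W (psi y) &
        forall y, V y -> local_rep q k i (psi y) = y].
Proof.
move=> dk di; have [cq _] := q_smooth; have [A0 [oA0 A0x qA0]] := q_inj x.
pose O' := chart_dom k `&` (q @^-1` chart_dom i `&` A0).
have oO' : open O'.
  apply: openI; first exact: chart_dom_open; apply: openI => //.
  by apply: open_comp => [y _|]; [exact: cq|exact: chart_dom_open].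
pose im (A : set M) := chart i @` (chart_dom i `&` q @` A).
have oim A : open A -> open (im A) by move=> oA; apply: chart_image_openI; exact: q_open.
(* The default [x] is taken only off the image of [O'], where nothing is claimed about [psi]. *)
pose r (y : 'rV[R]_m) := xget x [set x' | O' x' /\ chart i (q x') = y].
have rE x' : O' x' -> r (chart i (q x')) = x'.
  move=> Ox'; rewrite /r; case: xgetP => [x'' -> [[dk'' [di'' O'']] E]|/(_ x')[]//].
  case: Ox' => [dk' [di' O1]]; apply: qA0 => //.
  exact: etrans (esym (chartK di'')) (etrans (congr1 (chart_inv i) E) (chartK di')).
have imP y : im O' y -> exists2 x', O' x' & y = chart i (q x').
  by move=> [_ [_ [x' Ox' <-]] <-]; exists x'.
exists (chart k @` O'), (im O'), (chart k \o r).
have oW : open (chart k @` O').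
  apply: chart_image_openI; apply: openI => //.
  by apply: open_comp => [y _|]; [exact: cq|exact: chart_dom_open].
have WI : chart k @` O' `<=` chart k @` (chart_dom k `&` q @^-1` chart_dom i).
  by move=> _ [x' [dk' [di' _]] <-]; exists x'.
have repE x' : O' x' -> local_rep q k i (chart k x') = chart i (q x').
  by move=> [dk' _]; rewrite /local_rep /= chartK.
have V1 z : (chart k @` O') z -> im O' (local_rep q k i z).
  move=> [x' Ox' <-]; rewrite repE//; exists (q x') => //.
  by split; [case: Ox' => ? []|exists x'].
have V2 y : im O' y -> (chart k @` O') ((chart k \o r) y).
  by move=> /imP[x' Ox' ->]; exists x' => //=; rewrite rE.
have V3 y : im O' y -> local_rep q k i ((chart k \o r) y) = y.
  by move=> /imP[x' Ox' ->] /=; rewrite rE// repE.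
split; split => //.
- exact: oim.
- by exists x.
- apply: (inverse_smooth oW (oim _ oO') V2 V3).
  + move=> y /imP[x' Ox' ->] A /= nA.
    have nB : nbhs x' (chart k @^-1` A).
      by apply: chart_continuous; [case: Ox'|move: nA; rewrite rE].
    have nim : nbhs (chart i (q x')) (im (O' `&` interior (chart k @^-1` A))).
      apply: open_nbhs_nbhs; split; first by apply: oim; apply: openI => //; exact: open_interior.
      exists (q x') => //; split; first by case: Ox' => ? [].
      by exists x'.
    apply: filterS nim => _ [_ [_ [x'' [Ox'' /interior_subset Ax''] <-]] <-].
    by rewrite /= rE.
  + by move=> d; apply: Ck_on_sub WI _; case: q_smooth => _; exact.
  + move=> _ [x' [dk' [di' _]] <-]; exact: local_rep_unit.
- by move=> z [x' Ox' <-]; rewrite repE//= rE.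
Qed.

End local_section.

(** * The flow on the quotient and its Killing equation *)

Section trilinear.
Variables (R : realType) (E : normedModType R).

Lemma is_derive_sumfun n (h : 'I_n -> E -> R) (x v : E) (dh : 'I_n -> R) :
  (forall i, is_derive x v (h i) (dh i)) ->
  is_derive x v (fun e => \sum_i h i e) (\sum_i dh i).
Proof.
move=> H; rewrite (_ : (fun e => _) = \sum_i h i); first exact: is_derive_sum.
by apply/funext => e; rewrite fct_sumE.
Qed.

Lemma is_derive_coord n (A : E -> 'rV[R]_n) (x v : E) dA j :
  is_derive x v A dA -> is_derive x v (fun e => A e 0 j) (dA 0 j).
Proof.
move=> [dAx <-]; rewrite derive_coord//; split=> //.
by have /derivable_mxP := dAx.
Qed.

Lemma is_derive_trilinear n (A B : E -> 'rV[R]_n) (G : 'I_n -> 'I_n -> E -> R)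
    (x v : E) dA dB dG :
  is_derive x v A dA -> is_derive x v B dB ->
  (forall i j, is_derive x v (G i j) (dG i j)) ->
  is_derive x v (fun e => \sum_i \sum_j A e 0 i * B e 0 j * G i j e)
    (\sum_i \sum_j A x 0 i * B x 0 j * dG i j
     + \sum_i \sum_j dA 0 i * B x 0 j * G i j x
     + \sum_i \sum_j A x 0 i * dB 0 j * G i j x).
Proof.
move=> hA hB hG; rewrite -!big_split /=; apply: is_derive_sumfun => i.
rewrite -!big_split /=; apply: is_derive_sumfun => j.
have hAi := is_derive_coord i hA; have hBj := is_derive_coord j hB.
by apply: is_derive_eq; rewrite /GRing.scale /=; ring.
Qed.

End trilinear.

Section descended_flow.
Variables (R : realType) (m : nat) (M N : metric_manifold R m).
Variables (a : R -> M -> M) (q : M -> N) (b : R -> N -> N).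
Hypothesis a0 : forall x, a 0 x = x.
Hypothesis aD : forall s t x, a (s + t) x = a s (a t x).
Hypothesis a_smooth : smooth_family a.
Hypothesis a_isometry : forall t, local_isometry (a t).
Hypothesis q_isometry : local_isometry q.
Hypothesis q_surj : forall y, exists x, q x = y.
Hypothesis q_open : forall O : set M, open O -> open (q @` O).
Hypothesis q_inj : forall x, exists O : set M, [/\ open O, O x &
    forall x1 x2, O x1 -> O x2 -> q x1 = q x2 -> x1 = x2].
Hypothesis bq : forall t x, b t (q x) = q (a t x).

Let q_smooth : smooth_map q := q_isometry.1.

Lemma descended_flow0 y : b 0 y = y.
Proof. by have [x <-] := q_surj y; rewrite bq a0. Qed.

Lemma descended_flowD s t y : b (s + t) y = b s (b t y).
Proof. by have [x <-] := q_surj y; rewrite !bq aD. Qed.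

Lemma descended_flow_continuous y : continuous (b^~ y).
Proof.
have [x <-] := q_surj y.
rewrite (_ : b^~ (q x) = q \o (fun t => a t x)); last by apply/funext => t; rewrite /= bq.
move=> t; apply: continuous_comp; last by case: q_smooth => + _; exact.
apply: (@continuous_pair1 _ _ _ (fun z : R * M => a z.1 z.2)).
by case: a_smooth => + _; exact.
Qed.

Lemma descended_flow_derivable y i : chart_dom i y ->
  derivable (fun t => chart i (b t y)) 0 1.
Proof.
have [x <-] := q_surj y => di; pose k := chart_at x.
have S := @family_rep_smooth _ _ _ _ a_smooth _ _ _ q_smooth k i 1%N.
have dx : chart_dom k x by exact: chart_atP.
have dom : family_dom a q k i (0, chart k x) by exists x; split => //=; rewrite a0.
have := (derivable_pair1 _ _ _).2 (Ck_on_derivable S dom).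
have -> : (fun t => chart i (b t (q x))) = fun t => family_rep a q k i (t, chart k x).
  by apply/funext => t; rewrite /family_rep /= (chartK dx) bq.
exact.
Qed.

Let X := flow_field b.

Lemma descended_field_rep k i x : chart_dom k x -> chart_dom i (q x) ->
  local_field X i (chart i (q x)) = 'D_(1, 0) (family_rep a q k i) (0, chart k x).
Proof.
move=> dk di; rewrite (flow_local_field descended_flow0 descended_flow_continuous
  descended_flow_derivable (chart_image di)).
rewrite (chartK di) -derive_pair1.
have -> : (fun t => chart i (b t (q x))) = fun t => family_rep a q k i (t, chart k x).
  by apply/funext => t; rewrite /family_rep /= (chartK dk) bq.
exact.
Qed.

(** Near [chart i (q x)] the field is the time derivative at 0 of [q (a t x')], smooth in the point
    [x'] of [M], composed with a local section of [q]. *)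
Lemma descended_field_smooth : smooth_field X.
Proof.
move=> i d; apply: Ck_on_local => _ [y di <-].
have [x qx] := q_surj y; rewrite -{}qx in di *.
pose k := chart_at x; have dk : chart_dom k x by exact: chart_atP.
have [W [V [psi [[oW oV Wx spsi] [WI WV psiK VW repK]]]]] :=
  local_section q_smooth q_isometry.2 q_open q_inj dk di.
exists V; first by have := WV _ Wx; rewrite /local_rep /= chartK.
apply: (@Ck_on_eq _ _ _ _ _
  ((fun z => 'D_(1, 0) (family_rep a q k i) (0, z)) \o psi)) => //.
  move=> y' Vy; have [x' [dk' di'] E] := WI _ (VW _ Vy).
  rewrite /= -E -(descended_field_rep dk' di'); congr local_field.
  by rewrite -[RHS](repK _ Vy) -E /local_rep /= chartK.
apply: (Ck_on_comp_rV oV oW VW (spsi d)).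
have S := @family_rep_smooth _ _ _ _ a_smooth _ _ _ q_smooth k i d.+1.
apply: (@Ck_on_sub _ _ _ d [set z | family_dom a q k i (0, z)]); last first.
  exact: Ck_on_slice2 (Ck_on_derive _ S).
by move=> z /WI[x' [dk' di'] <-]; exists x'; split => //=; rewrite a0.
Qed.

(* In the chart [i], the flow at time [t] followed by [q] is [P (t, -)]. It
   preserves the metric, so that differentiating the inner product of the images
   of two fixed vectors at [t = 0] yields the Killing equation, as mixed partial
   derivatives commute. *)
Lemma descended_field_killing : killing X.
Proof.
split; first exact: descended_field_smooth.
move=> i _ v w [y di <-]; have [x qx] := q_surj y; rewrite -{}qx in di *.
pose k := chart_at x; have dk : chart_dom k x by exact: chart_atP.
pose P := family_rep a q k i; pose z0 := chart k x; pose y0 := chart i (q x).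
pose U := family_dom a q k i.
have oU : open U := @family_dom_open_rep _ _ _ _ a_smooth _ _ _ q_smooth k i.
have sP : smooth_on U P := @family_rep_smooth _ _ _ _ a_smooth _ _ _ q_smooth k i.
have U0 : U (0, z0) by exists x; split => //=; rewrite a0.
have P0 : P (0, z0) = y0 by rewrite /P /family_rep /= chartK// a0.
have nearU : \forall t \near (0 : R), U (t, z0).
  have c0 : {for (0 : R), continuous (fun t : R => (t, z0))}.
    by apply: continuous_pair; [exact: cvg_id|exact: cst_continuous].
  by apply: c0; exact: open_nbhs_nbhs.
have y0i : (chart i @` chart_dom i) y0 by exists (q x).
pose J := jacobian_mx (local_rep q k i) z0.
have uJ : J \in unitmx by exact: local_rep_unit q_smooth q_isometry.2 _ _ _ dk di.
have dq : differentiable (local_rep q k i) z0 by exact: local_rep_differentiable.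
have Pq z : P (0, z) = local_rep q k i z by rewrite /P /family_rep /local_rep /= a0.
(* [u *m invmx J] is the lift of [u] through the differential of [q], so its image at time 0 is the
   prescribed vector [u]. *)
have DP u : 'D_(0, u *m invmx J) P (0, z0) = u.
  rewrite -derive_pair2 (_ : (fun z => _) = local_rep q k i); last exact/funext.
  by rewrite jacobian_mxE// -/J mulmxKV.
pose G c d := gram_local (@gram R m N) i (delta_mx 0 c) (delta_mx 0 d).
have dG c d y' : (chart i @` chart_dom i) y' -> differentiable (G c d) y'.
  apply: C1_differentiable_scalar (@gram_smooth R m N i _ _ 1%N).
  exact: chart_image_open.
have DX : local_field X i y0 = 'D_(1, 0) P (0, z0) by exact: descended_field_rep.
set xi := local_field X i y0.
have dP : is_derive (0 : R) (1 : R) (fun t => P (t, z0)) xi.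
  split; last by rewrite /xi DX derive_pair1.
  exact: (derivable_pair1 P 0 z0).2 (Ck_on_derivable (sP 1%N) U0).
have dX : differentiable (local_field X i) y0.
  apply: C1_differentiable (descended_field_smooth i 1%N) y0i.
  exact: chart_image_open.
(* After exchanging the two derivatives, the velocity ['D_(1, 0) P (0, z)] is differentiated along
   the lift of [u]. This velocity is the field composed with [q], and the chain rule leaves the
   derivative of the field along [u]. *)
have DDP u : is_derive (0 : R) (1 : R) (fun t => 'D_(0, u *m invmx J) P (t, z0))
    ('D_u (local_field X i) y0).
  split.
    exact: (derivable_pair1 ('D_(0, u *m invmx J) P) 0 z0).2
      (Ck_on_derivable (Ck_on_derive _ (sP 2%N)) U0).
  rewrite (derive_pair1 ('D_(0, u *m invmx J) P)) (derive_comm_rV _ _ oU (sP 2%N) U0).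
  rewrite -(derive_pair2 ('D_(1, 0) P)).
  have dqu : is_derive z0 (u *m invmx J) (local_rep q k i) u.
    by split; [exact: diff_derivable|rewrite jacobian_mxE// -/J mulmxKV].
  have Eq0 : local_rep q k i z0 = y0 by rewrite -Pq.
  have dX' : differentiable (local_field X i) (local_rep q k i z0) by rewrite Eq0.
  have [_] := is_derive_comp dqu dX'.
  rewrite Eq0 => <-; apply: near_eq_derive.
  have oq : open (q @^-1` chart_dom i).
    by apply: open_comp => [? _|]; [case: q_smooth => + _; exact|exact: chart_dom_open].
  apply: filterS (near_chart_inv dk oq di) => z [[x' dk' <-]].
  rewrite /preimage /= (chartK dk') => di'.
  have repx : local_rep q k i (chart k x') = chart i (q x').
    by rewrite /local_rep /= (chartK dk').
  by rewrite repx; exact (esym (descended_field_rep dk' di')).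
pose u1 := v *m invmx J; pose u2 := w *m invmx J.
(* [q \o a t] preserves the metric, so the images of the two lifts keep the inner product of the
   lifts at [z0], as long as the orbit stays over chart [i]. *)
have const : \forall t \near (0 : R), \sum_c \sum_d
    ('D_(0, u1) P (t, z0)) 0 c * ('D_(0, u2) P (t, z0)) 0 d * G c d (P (t, z0)) =
    gram_local (@gram R m M) k u1 u2 z0.
  apply: filterS nearU => t [x' [dk' /= zx' di']].
  have {dk' zx'} x'E : x' = x by rewrite -(chartK dk') zx' chartK.
  rewrite {}x'E in di'.
  have [sf pf] := local_isometry_comp (a_isometry t) q_isometry.
  have PE : P (t, z0) = chart i (q (a t x)) by rewrite /P /family_rep /= chartK.
  rewrite -(gram_local_isometry u1 u2 sf pf dk di') /= -/z0.
  rewrite [in RHS]gram_local_sum; last by exists (q (a t x)).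
  have DE u : 'D_u (local_rep (q \o a t) k i) z0 = 'D_(0, u) P (t, z0).
    by rewrite -derive_pair2.
  by rewrite !DE PE.
have dGP c d : is_derive (0 : R) (1 : R) (fun t => G c d (P (t, z0))) ('D_xi (G c d) y0).
  have dGP0 : differentiable (G c d) (P (0, z0)) by rewrite P0; exact: dG.
  by have := is_derive_comp dP dGP0; rewrite P0.
have D1 := is_derive_trilinear (DDP v) (DDP w) dGP.
have D2 : is_derive (0 : R) (1 : R) (fun t : R => gram_local (@gram R m M) k u1 u2 z0) 0.
  exact: is_derive_cst.
have [_ D3] := near_eq_is_derive const D1.
move: D3; rewrite (@derive_val _ _ _ _ _ _ _ D2) => D3.
rewrite -/y0 -/xi.
(* The same differentiation rule for constant [v] and [w], whose derivatives vanish, isolates the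
   term that differentiates the metric. *)
have D4 : 'D_xi (gram_local (@gram R m N) i v w) y0 =
    \sum_c \sum_d v 0 c * w 0 d * 'D_xi (G c d) y0.
  have dGy c d : is_derive y0 xi (G c d) ('D_xi (G c d) y0).
    by split => //; apply: diff_derivable; exact: dG.
  have dc (u : 'rV[R]_m) : is_derive y0 xi (fun=> u) 0 by exact: is_derive_cst.
  have [_ D5] := is_derive_trilinear (dc v) (dc w) dGy.
  have near5 : \forall y' \near y0, gram_local (@gram R m N) i v w y' =
      \sum_c \sum_d v 0 c * w 0 d * G c d y'.
    apply: (near_open (@chart_image_open _ _ N i) y0i) => y' iy'.
    exact: gram_local_sum.
  apply: (etrans (near_eq_derive xi near5)); apply: (etrans D5).
  rewrite [X in _ + X + _]big1 ?[X in _ + X]big1 ?addr0//.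
    by move=> c _; apply: big1 => d _; rewrite mxE mulr0 mul0r.
  by move=> c _; apply: big1 => d _; rewrite mxE !mul0r.
rewrite P0 (DP v) (DP w) in D3.
move=> Xi; rewrite -[Xi y0]/xi D4.
rewrite (gram_local_sum ('D_v Xi y0) w y0i) (gram_local_sum v ('D_w Xi y0) y0i).
exact: esym D3.
Qed.

End descended_flow.

(** * Closed conditions and connectedness *)

Lemma near_preimage (S T : topologicalType) (g : S -> T) (x : S) (z : T)
    (P : T -> Prop) :
  g y @[y --> x] --> z -> (\forall z' \near z, P z') -> nbhs x [set y | P (g y)].
Proof. by move=> cg; exact: cg. Qed.

Lemma closed_eq_fun (S T : topologicalType) (c1 c2 : S -> T) :
  hausdorff_space T -> continuous c1 -> continuous c2 ->
  closed [set t | c1 t = c2 t].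
Proof.
rewrite open_hausdorff => hT cc1 cc2.
rewrite -[X in closed X]setCK; apply: open_closedC.
rewrite openE => t /= /eqP /hT[[A B] /= [/[!inE] At Bt] [oA oB AB]].
have nA : nbhs t (c1 @^-1` A) by apply: cc1; exact: open_nbhs_nbhs.
have nB : nbhs t (c2 @^-1` B) by apply: cc2; exact: open_nbhs_nbhs.
apply: filterS (filterI nA nB) => s [As Bs] E.
have : (A `&` B) (c1 s) by split=> //; rewrite E.
by rewrite AB.
Qed.

Lemma connected_clopen (T : topologicalType) (A : set T) :
  connected [set: T] -> A !=set0 -> open A -> closed A -> A = [set: T].
Proof.
move=> cT A0 oA cA; apply: cT => //; first by exists A => //; rewrite setTI.
by exists A => //; rewrite setTI.
Qed.

Lemma connected_real (R : realType) : connected [set: R].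
Proof. by apply/connected_intervalP. Qed.

(** * Integral curves *)

Section integral_curves.
Variable R : realType.

(** Let [c] maximize the norm of the gap [w] on the interval of radius [T] around [t0]. The mean
    value theorem and the Lipschitz bound show that this maximum is at most [T * K] times itself,
    hence at most its half, so it vanishes. *)
Lemma ode_local_unique n (X : 'rV[R]_n -> 'rV[R]_n) (y0 : 'rV[R]_n) (d K e : R)
    (u1 u2 : R -> 'rV[R]_n) (t0 : R) :
  0 < K ->
  (forall y z, `|y0 - y| < d -> `|y0 - z| < d -> `|X y - X z| <= K * `|y - z|) ->
  (forall t, `|t0 - t| < e -> [/\ `|y0 - u1 t| < d, `|y0 - u2 t| < d,
     is_derive t 1 u1 (X (u1 t)) & is_derive t 1 u2 (X (u2 t))]) ->
  u1 t0 = u2 t0 ->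
  forall t, `|t0 - t| < e -> `|t0 - t| * K <= 2^-1 -> u1 t = u2 t.
Proof.
move=> K0 lip H u0 t te tK; set T := `|t0 - t| in te tK.
pose w s := u1 s - u2 s.
have T0 : 0 <= T by exact: normr_ge0.
have Ie s : s \in `[t0 - T, t0 + T] -> `|t0 - s| <= T.
  by rewrite in_itv /= => /andP[s1 s2]; rewrite ler_norml; lra.
have dw s : `|t0 - s| < e -> is_derive s 1 w (X (u1 s) - X (u2 s)).
  by move=> se; have [_ _ d1 d2] := H s se; exact: is_deriveB.
have cw : {within `[t0 - T, t0 + T], continuous (fun s => `|w s|)}.
  apply: continuous_in_subspaceT => s /[!inE] sI.
  apply: (@continuous_comp _ _ _ w (fun z => `|z|)); last exact: norm_continuous.
  apply: differentiable_continuous; apply/derivable1_diffP.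
  by have [] := dw s (le_lt_trans (Ie s sI) te).
have [|c cI cmax] := EVT_max _ cw; first by lra.
have cT := Ie c cI.
have wc : `|w c| <= 2^-1 * `|w c|.
  apply: row_norm_leP => [|i j]; first by rewrite mulr_ge0// invr_ge0.
  rewrite {i}ord1.
  have sub s : 0 <= s <= 1 -> `|t0 - (s *: (c - t0) + t0)| <= T.
    move=> /andP[s0 s1]; rewrite opprD addrCA subrr addr0 normrN normrZ ger0_norm//.
    by rewrite distrC; apply: le_trans cT; rewrite ler_piMl.
  have dj s : `|t0 - s| < e -> is_derive s 1 (fun s => w s 0 j) ((X (u1 s) - X (u2 s)) 0 j).
    by move=> se; apply: is_derive_coord; exact: dw.
  have djc s : `|t0 - s| < e ->
      is_derive s (c - t0) (fun s => w s 0 j) ((c - t0) * (X (u1 s) - X (u2 s)) 0 j).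
    move=> se; have [d1 <-] := dj s se.
    by have := is_derive_scale (c - t0) d1; rewrite [(c - t0) *: 1]mulr1.
  have [s s01] := @mvt_dir _ _ (fun s => w s 0 j) t0 (c - t0)
    (fun s s01 => @ex_derive _ _ _ _ _ _ _ (djc _ (le_lt_trans (sub s s01) te))).
  have w0j : w t0 0 j = 0 by rewrite /w u0 subrr mxE.
  have se := le_lt_trans (sub s s01) te; set s' := s *: (c - t0) + t0 in se.
  have [_ ->] := djc s' se; rewrite subrK w0j subr0 => ->.
  have [B1 B2 _ _] := H s' se.
  rewrite normrM distrC.
  have L1 : `|(X (u1 s') - X (u2 s')) 0 j| <= K * `|w c|.
    apply: le_trans (row_norm_le _ _ _) _; apply: le_trans (lip _ _ B1 B2) _.
    rewrite ler_pM2l//; apply: cmax; rewrite in_itv /=.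
    by have := sub s s01; rewrite -/s' ler_norml; lra.
  apply: le_trans (_ : T * (K * `|w c|) <= _); first by apply: ler_pM.
  by rewrite mulrA ler_wpM2r.
have : `|w c| <= 0 by have := normr_ge0 (w c); lra.
rewrite normr_le0 => /eqP wc0.
have : `|w t| <= `|w c|.
  apply: cmax; rewrite in_itv /=.
  by have : `|t0 - t| <= T by []; rewrite ler_norml; lra.
by rewrite wc0 normr0 normr_le0 subr_eq0 => /eqP.
Qed.

Variables (n : nat) (N : smooth_manifold R n) (X : N -> 'rV[R]_n).

Lemma integral_curve_chart c t (i : chart_index N) :
  integral_curve X c -> chart_dom i (c t) ->
  is_derive t 1 (chart i \o c) (local_field X i (chart i (c t))).
Proof.
move=> [cc dc] di.
have := is_derive_chart (smooth_id N) (cc t) (chart_atP (c t)) di (dc t).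
by rewrite /local_field chartK.
Qed.

(** The set of times at which the curves agree contains 0, is closed since [N] is Hausdorff, and is
    open by local uniqueness in a chart, where a smooth field is Lipschitz. *)
Lemma integral_curve_unique c1 c2 :
  smooth_field X -> integral_curve X c1 -> integral_curve X c2 ->
  c1 0 = c2 0 -> c1 = c2.
Proof.
move=> sX ic1 ic2 c0; apply/funext => t.
suff : [set t | c1 t = c2 t] = [set: R] by move=> E; have : [set: R] t by []; rewrite -E.
apply: connected_clopen; [exact: connected_real|by exists 0| |]; last first.
  by apply: closed_eq_fun; [exact: manifold_hausdorff|case: ic1|case: ic2].
rewrite openE => t0 /= E0.
pose i := chart_at (c1 t0); have di : chart_dom i (c1 t0) by exact: chart_atP.
pose y0 := chart i (c1 t0).
have [d [K [d0 K0 lip]]] := C1_lipschitz (@chart_image_open _ _ N i) (sX i 1%N) (chart_image di).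
have near_c c : integral_curve X c -> c t0 = c1 t0 ->
    \forall t \near t0, chart_dom i (c t) /\ `|y0 - chart i (c t)| < d.
  move=> [cc _] ct0.
  have n1 : nbhs t0 (c @^-1` chart_dom i).
    by apply: cc; rewrite ct0; apply: open_nbhs_nbhs; split=> //; exact: chart_dom_open.
  have cci : {for t0, continuous (chart i \o c)}.
    by apply: continuous_comp; [exact: cc|rewrite ct0; exact: chart_continuous].
  have {}cci : (chart i \o c) t @[t --> t0] --> y0 by rewrite /y0 -ct0.
  by move/cvgrPdist_lt : cci => /(_ _ d0) H; exact: (filterI n1 H).
have [e e0 He] := near_norm_ball (filterI (near_c c1 ic1 erefl) (near_c c2 ic2 (esym E0))).
apply/nbhs_normP; exists (Num.min e (2 * K)^-1).
  by rewrite /= lt_min e0 invr_gt0 mulr_gt0.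
move=> s /=; rewrite lt_min => /andP[se sK].
have [[d1 b1] [d2 b2]] := He _ se.
rewrite -(chartK d1) -(chartK d2); congr chart_inv.
apply: (@ode_local_unique _ (local_field X i) y0 d K e (chart i \o c1) (chart i \o c2) t0)
  => //=; last 2 first.
- by rewrite E0.
- by rewrite -ler_pdivlMr// -invfM ltW.
move=> r re; have [[dr1 br1] [dr2 br2]] := He _ re.
by split=> //; exact: integral_curve_chart.
Qed.

End integral_curves.

(** * Maps of finite order *)

Section finite_order.
Variable R : realType.

(* If [f] has order dividing [k] along the orbit of [y], then the displacements
   [f z - z] along the orbit add up to [0]; being all close to the first one,
   they vanish. *)
Lemma finite_order_fixed n (f : 'rV[R]_n -> 'rV[R]_n) (B : set 'rV[R]_n) k (e : R)
    (y : 'rV[R]_n) :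
  0 <= e -> k%:R * (e * 2 ^+ k) <= 2^-1 ->
  (forall y z, B y -> B z -> `|f y - f z - (y - z)| <= e * `|y - z|) ->
  (forall j, (j < k)%N -> B (iter j f y)) ->
  iter k f y = y -> (0 < k)%N -> f y = y.
Proof.
move=> e0 ke lip By fk k0.
pose D j := f (iter j f y) - iter j f y.
have De j : (j.+1 < k)%N -> `|D j.+1 - D j| <= e * `|D j|.
  move=> jk; have jk' : (j < k)%N := ltnW jk.
  have := lip _ _ (By _ jk) (By _ jk'); rewrite /D iterS.
  exact.
(* With [e <= 1], each displacement is at most twice the preceding one, which is the source of the
   factor [2 ^+ k]. *)
have e1 : e <= 1.
  have k1 : 1 <= k%:R * 2 ^+ k :> R.
    by apply: mulr_ege1; rewrite ?ler1n// exprn_ege1// ler1n.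
  have : e * 1 <= e * (k%:R * 2 ^+ k) by rewrite ler_wpM2l.
  by rewrite mulr1 mulrCA; move: ke; lra.
have D2 j : (j < k)%N -> `|D j| <= 2 ^+ j * `|D 0%N|.
  elim: j => [|j IH] jk; first by rewrite expr0 mul1r.
  have {}IH := IH (ltnW jk).
  rewrite -(subrK (D j) (D j.+1)); apply: le_trans (ler_normD _ _) _.
  rewrite exprS -mulrA; have := De j jk.
  have : e * `|D j| <= 1 * `|D j| by rewrite ler_wpM2r.
  by move: IH; lra.
have De' j : (j.+1 < k)%N -> `|D j.+1 - D j| <= e * 2 ^+ k * `|D 0%N|.
  move=> jk; apply: le_trans (De j jk) _; rewrite -mulrA ler_wpM2l//.
  apply: le_trans (D2 _ (ltnW jk)) _; rewrite ler_wpM2r//.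
  by rewrite ler_weXn2l ?ler1n// ltnW// ltnW.
have D0 j : (j < k)%N -> `|D j - D 0%N| <= j%:R * (e * 2 ^+ k * `|D 0%N|).
  elim: j => [|j IH] jk; first by rewrite subrr normr0 mul0r.
  rewrite -(subrKA (D j)) -natr1 mulrDl mul1r [leRHS]addrC.
  apply: le_trans (ler_normD _ _) _; apply: lerD.
    exact: De'.
  exact: IH (ltnW jk).
have sumD : \sum_(0 <= j < k) D j = 0.
  by rewrite (telescope_sumr (fun j => iter j f y))// fk subrr.
(* As the [D j] add up to 0, [k%:R *: D 0] is minus the sum of the differences [D j - D 0], each at
   most half of [D 0] in norm. *)
have kD : k%:R * `|D 0%N| <= k%:R * (2^-1 * `|D 0%N|).
  have -> : k%:R * `|D 0%N| = `|k%:R *: D 0%N| by rewrite normrZ normr_nat.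
  have -> : k%:R *: D 0%N = - \sum_(j < k) (D j - D 0%N).
    rewrite sumrB -(big_mkord predT) sumD sub0r opprK sumr_const card_ord.
    by rewrite scaler_nat.
  rewrite normrN; apply: le_trans (ler_norm_sum _ _ _) _.
  apply: (@le_trans _ _ (\sum_(j < k) 2^-1 * `|D 0%N|)).
    apply: ler_sum => j _; apply: le_trans (D0 _ (ltn_ord j)) _.
    rewrite mulrA ler_wpM2r//; apply: le_trans ke.
    by rewrite ler_wpM2r ?mulr_ge0 ?exprn_ge0// ler_nat ltnW.
  by rewrite sumr_const card_ord mulr_natl.
have : `|D 0%N| <= 0.
  have := normr_ge0 (D 0%N); move: kD; rewrite ler_pM2l ?ltr0n//; lra.
by rewrite normr_le0 subr_eq0 => /eqP.
Qed.

(** The interior [F] of the fixed set is shown to be closed. At a limit point [x0] of [F],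
    continuity makes [f] fix [x0] with the identity as derivative. In a chart around [x0], [f] minus
    the identity is then Lipschitz with a small constant, and finite order forces nearby points to
    be fixed. *)
Lemma finite_order_open_fixed n (M : smooth_manifold R n) (f : M -> M) k
    (A : set M) :
  connected [set: M] -> smooth_map f -> (0 < k)%N ->
  (forall x, iter k f x = x) ->
  open A -> A !=set0 -> (forall x, A x -> f x = x) -> forall x, f x = x.
Proof.
move=> cM sf k0 fk oA A0 fA x; have [cf sf'] := sf.
pose F := interior [set x | f x = x].
suff E : F = [set: M].
  have : F x by rewrite E.
  exact: interior_subset.
have oF : open F by exact: open_interior.
apply: connected_clopen => //.
  have [x0 Ax0] := A0; exists x0; apply: filterS (open_nbhs_nbhs (conj oA Ax0)).
  by move=> ?; exact: fA.
have cfix : closed [set x | f x = x].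
  by apply: closed_eq_fun => //; [exact: manifold_hausdorff|move=> y; exact: cvg_id].
move=> x0 clx0.
have fx0 : f x0 = x0.
  apply: cfix; apply: closure_subset clx0; exact: interior_subset.
pose i := chart_at x0; have di : chart_dom i x0 by exact: chart_atP.
pose z0 := chart i x0; pose h := local_rep f i i.
pose U := chart i @` (chart_dom i `&` f @^-1` chart_dom i).
have oU : open U by exact: local_rep_dom_open.
have h1 : Ck_on 1 U h by exact: sf'.
have Uz0 : U z0 by exists x0 => //; split => //=; rewrite fx0.
have Dh v : 'D_v h z0 = v.
  apply: contrapT => /eqP Dv.
  have d0 : 0 < `|'D_v h z0 - v| by rewrite normr_gt0 subr_eq0.
  have cD : 'D_v h z @[z --> z0] --> 'D_v h z0.
    exact: Ck_on_continuous (Ck_on_derive v h1) Uz0.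
  move/cvgrPdist_lt : cD => /(_ _ d0) nD.
  have nM : nbhs x0 (chart_dom i `&`
      [set y | `|'D_v h z0 - 'D_v h (chart i y)| < `|'D_v h z0 - v|]).
    apply: filterI.
      by apply: open_nbhs_nbhs; split=> //; exact: chart_dom_open.
    have cc : chart i y @[y --> x0] --> z0 by exact: chart_continuous.
    exact (@near_preimage _ _ (chart i) x0 z0
      (fun z => `|'D_v h z0 - 'D_v h z| < `|'D_v h z0 - v|) cc nD).
  have [y [Fy [dy Dy]]] := clx0 _ nM.
  move: Dy; rewrite /mkset; suff -> : 'D_v h (chart i y) = v by rewrite ltxx.
  rewrite -[RHS](derive_id (chart i y)); apply: near_eq_derive.
  apply: filterS (near_chart_inv dy oF Fy) => z [iz /interior_subset /= fz].
  by rewrite /h /local_rep /= fz chart_invK.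
(* This makes [k%:R * (e * 2 ^+ k)] exactly 1/2. *)
pose e : R := (2 * k%:R * 2 ^+ k)^-1.
have kk : 0 < k%:R :> R by rewrite ltr0n.
have e0 : 0 < e by rewrite invr_gt0 !mulr_gt0// exprn_gt0.
have ke : k%:R * (e * 2 ^+ k) <= 2^-1.
  rewrite /e !invfM; have : (2 : R) ^+ k != 0 by rewrite gt_eqF// exprn_gt0.
  have : k%:R != 0 :> R by rewrite gt_eqF.
  by move=> A1 A2; rewrite le_eqVlt; apply/orP; left; apply/eqP; field; rewrite A1 A2.
have [d d0 Hd] := C1_strict oU h1 Uz0 e0.
have citer j : continuous (iter j f).
  by elim: j => [|j IH] y; [exact: cvg_id|apply: continuous_comp; [exact: IH|exact: cf]].
have iter0 j : iter j f x0 = x0 by elim: j => //= j ->.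
have nx (j : 'I_k.+1) : \forall y \near x0, chart_dom i (iter j f y) /\
    `|z0 - chart i (iter j f y)| < d.
  have n1 : nbhs x0 (iter j f @^-1` chart_dom i).
    apply: citer; rewrite iter0; apply: open_nbhs_nbhs; split => //.
    exact: chart_dom_open.
  have cc : {for x0, continuous (chart i \o iter j f)}.
    apply: continuous_comp; first exact: citer.
    by rewrite iter0; exact: chart_continuous.
  have {}cc : (chart i \o iter j f) y @[y --> x0] --> z0.
    by have := cc; rewrite /prop_for /continuous_at /= iter0.
  by move/cvgrPdist_lt : cc => /(_ _ d0) H; exact: (filterI n1 H).
apply: filterS (near_forall nx) => y Hy.
have hj j : (j <= k)%N -> iter j h (chart i y) = chart i (iter j f y).
  elim: j => [//|j IH] jk; rewrite iterS IH ?(ltnW jk)// /h /local_rep /= chartK//.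
  have := Hy (Ordinal (leqW jk : (j < k.+1)%N)); by case.
have d1 : chart_dom i (f y) by have [] := Hy (Ordinal (k0 : (1 < k.+1)%N)).
have dy : chart_dom i y by have [] := Hy ord0.
rewrite /= -(chartK d1) -[RHS](chartK dy); congr chart_inv.
have := hj 1%N k0; rewrite /= => <-.
apply: (@finite_order_fixed _ h [set z | `|z0 - z| < d] k e) => //; first exact: ltW.
- by move=> y' z' By' Bz'; have := Hd _ _ By' Bz'; rewrite Dh.
- by move=> j jk; rewrite /= hj ?(ltnW jk)//; have [] := Hy (Ordinal (leqW jk)).
- by rewrite hj// fk.
Qed.

End finite_order.

(** * Riemannian distance *)

Section integral_comparison.
Variable R : realType.
Let mu := @lebesgue_measure R.

Lemma continuous_antiderivative (f : R -> R) (a b : R) :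
  a <= b -> continuous f ->
  exists2 F : R -> R, (forall s, a <= s <= b -> is_derive s 1 F (f s)) &
    \int[mu]_(t in `[a, b]) f t = F b - F a.
Proof.
(* The primitive below starts at [a - 1], and integrability is used up to [b + 1], so that [a] and
   [b] are interior points and the derivative is two-sided there. *)
move=> ab cf.
have fint c d : mu.-integrable `[c, d] (EFin \o f).
  apply: continuous_compact_integrable; first exact: segment_compact.
  exact: continuous_subspaceT.
exists (fun s => \int[mu]_(t in `[a - 1, s]) f t).
  move=> s /andP[sa sb].
  have sb1 : s < b + 1 by rewrite (le_lt_trans sb)// ltrDl.
  have as1 : a - 1 < s by rewrite (lt_le_trans _ sa)// ltrBlDr ltrDl.
  have [dF F's] := continuous_FTC1_closed sb1 (fint (a - 1) (b + 1)) as1 (cf s).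
  by split; [exact: dF|rewrite -derive1E; exact: F's].
rewrite Rintegral_itvB; last 3 first.
- exact: fint.
- by rewrite bnd_simp lerBlDr lerDl.
- by rewrite bnd_simp.
rewrite Rintegral_itv_obnd_cbnd//.
apply: integrableS (fint a b) => //; exact: subset_itv_oc_cc.
Qed.

(** The supremum [t] of the points [s] with [g s - g a <= e * (s - a)] satisfies this inequality by
    continuity; were [t < b], the estimate to the right of [t] would produce a larger such point. *)
Lemma dini_nonincreasing (g : R -> R) (a b : R) : a <= b ->
  (forall s, a <= s <= b -> {for s, continuous g}) ->
  (forall s e, a <= s -> s < b -> 0 < e ->
     exists2 d, 0 < d & forall s', s < s' -> s' < s + d -> g s' - g s <= e * (s' - s)) ->
  g b <= g a.
Proof.
move=> ab cg H; apply/ler_addgt0Pr => e0 e00.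
have [e [ep eE]] : exists e, 0 < e /\ e * (b - a) <= e0.
  exists (e0 / (b - a + 1)).
  have ba1 : 0 < b - a + 1 by rewrite ltr_wpDl// subr_ge0.
  split; first exact: divr_gt0.
  by rewrite mulrAC ler_pdivrMr// ler_pM2l// lerDl.
pose S := [set s | a <= s <= b /\ g s - g a <= e * (s - a)].
have Sa : S a by split; [rewrite lexx ab|rewrite !subrr mulr0].
have supS : has_sup S by split; [exists a|exists b => s [/andP[]]].
pose t := sup S.
have clt : closure S t by apply: closure_sup; [exists a|exact: supS.2].
have tI : a <= t <= b.
  rewrite (ub_le_sup supS.2 Sa) /=; apply: ge_sup; first by exists a.
  by move=> s [/andP[]].
have St : S t.
  split=> //; rewrite leNgt; apply/negP => gt.
  pose h s := g s - g a - e * (s - a).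
  have ch : h s @[s --> t] --> h t.
    apply: cvgB; first by apply: cvgB; [exact: cg|exact: cvg_cst].
    by apply: cvgMr; apply: cvgB; [exact: cvg_id|exact: cvg_cst].
  have ht : 0 < h t by rewrite subr_gt0.
  have nh : \forall s \near t, 0 < h s by exact: cvgr_gt ch _ ht.
  have [s [[_ Ss]]] := clt _ nh.
  by rewrite /= /h subr_gt0 ltNge Ss.
have [/andP[at_ tb] gt] := St.
suff tE : t = b by move: gt; rewrite tE; move: eE; lra.
apply/eqP; rewrite eq_le tb leNgt; apply/negP => tb'.
have [d d0 Hd] := H t e at_ tb' ep.
pose s := Num.min b (t + d / 2).
have ts : t < s by rewrite lt_min tb' ltrDl divr_gt0.
have sd : s < t + d.
  by rewrite gt_min; apply/orP; right; rewrite ltrD2l ltr_pdivrMr// ltr_pMr// ltr1n.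
have Ss : S s.
  split; first by rewrite (le_trans at_ (ltW ts)) ge_min lexx.
  by have := Hd s ts sd; move: gt; lra.
by have := ub_le_sup supS.2 Ss; rewrite -/t leNgt ts.
Qed.

End integral_comparison.

(** * The norm of an inner product *)

Section inner_product_norm.
Variables (R : realType) (n : nat) (G : 'M[R]_n).
Hypothesis G_sym : G^T = G.
Hypothesis G_pos : forall v, v != 0 -> 0 < gram_inner G v v.

Definition gram_norm (v : 'rV[R]_n) := Num.sqrt (gram_inner G v v).

Let B := gram_inner G.

Let BC v w : B v w = B w v.
Proof.
rewrite /B /gram_inner.
have -> : (v *m G *m w^T) 0 0 = (v *m G *m w^T)^T 0 0 by rewrite [RHS]mxE.
by rewrite !trmx_mul trmxK G_sym mulmxA.
Qed.

Let BDl u v w : B (u + v) w = B u w + B v w.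
Proof. by rewrite /B /gram_inner !mulmxDl mxE. Qed.

Let BZl c v w : B (c *: v) w = c * B v w.
Proof. by rewrite /B /gram_inner -!scalemxAl mxE. Qed.

Let BDr u v w : B u (v + w) = B u v + B u w.
Proof. by rewrite BC BDl !(BC _ u). Qed.

Let BZr c v w : B v (c *: w) = c * B v w.
Proof. by rewrite BC BZl (BC _ v). Qed.

Let B_ge0 v : 0 <= B v v.
Proof.
have [->|v0] := eqVneq v 0; last exact/ltW/G_pos.
by rewrite /B /gram_inner !mul0mx mxE.
Qed.

Lemma gram_norm_ge0 v : 0 <= gram_norm v.
Proof. exact: sqrtr_ge0. Qed.

Lemma gram_norm_sqr v : gram_norm v ^+ 2 = gram_inner G v v.
Proof. by rewrite sqr_sqrtr// B_ge0. Qed.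

Lemma gram_norm0 : gram_norm 0 = 0.
Proof. by rewrite /gram_norm /gram_inner !mul0mx mxE sqrtr0. Qed.

Lemma gram_normZ c v : gram_norm (c *: v) = `|c| * gram_norm v.
Proof.
by rewrite /gram_norm -/B BZl BZr mulrA -expr2 sqrtrM ?sqr_ge0// sqrtr_sqr.
Qed.

Lemma gram_Cauchy_Schwarz v w : gram_inner G v w <= gram_norm v * gram_norm w.
Proof.
rewrite -/B; have [->|w0] := eqVneq w 0.
  by rewrite gram_norm0 mulr0 BC /B /gram_inner !mul0mx mxE.
have Qw : 0 < B w w by exact: G_pos.
have [Bn|Bp] := leP (B v w) 0.
  by apply: le_trans Bn _; rewrite mulr_ge0// gram_norm_ge0.
rewrite -(ler_pXn2r (n := 2)) ?nnegrE ?mulr_ge0 ?gram_norm_ge0 ?(ltW Bp)//.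
rewrite exprMn !gram_norm_sqr -/B.
(* This vector is the component of [v] orthogonal to [w], scaled by [B w w] to avoid a division. *)
have := B_ge0 (B w w *: v + (- B v w) *: w).
rewrite !(BDl, BDr, BZl, BZr) (BC w v) => H.
have {}H : 0 <= B w w * (B v v * B w w - B v w ^+ 2) by move: H; rewrite expr2; lra.
by move: H; rewrite pmulr_rge0// subr_ge0.
Qed.

Lemma gram_normD v w : gram_norm (v + w) <= gram_norm v + gram_norm w.
Proof.
rewrite -(ler_pXn2r (n := 2)) ?nnegrE ?addr_ge0 ?gram_norm_ge0//.
rewrite sqrrD !gram_norm_sqr -/B BDl !BDr (BC w v).
by have := gram_Cauchy_Schwarz v w; rewrite -/B; lra.
Qed.

Lemma gram_norm_le : exists2 C : R, 0 < C & forall v, gram_norm v <= C * `|v|.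
Proof.
exists (1 + \sum_(j < n) gram_norm (delta_mx 0 j)).
  by rewrite ltr_wpDr// sumr_ge0// => j _; exact: gram_norm_ge0.
move=> v; rewrite {1}[v]row_sum_delta mulrDl mul1r.
apply: (@le_trans _ _ (\sum_(j < n) gram_norm (v 0 j *: delta_mx 0 j))).
  elim/big_ind2 : _ => [|x1 x2 y1 y2 h1 h2|j _]; first by rewrite gram_norm0.
    by apply: le_trans (gram_normD _ _) _; exact: lerD.
  exact: lexx.
rewrite mulr_suml; apply: le_trans (_ : _ <= \sum_(j < n) gram_norm (delta_mx 0 j) * `|v|) _.
  apply: ler_sum => j _; rewrite gram_normZ mulrC ler_wpM2l ?gram_norm_ge0//.
  exact: row_norm_le.
by rewrite lerDr.
Qed.

(* The coordinate [v 0 j] is the inner product of [v] with the dual basis. *)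
Lemma norm_le_gram_norm : exists2 C : R, 0 < C & forall v : 'rV[R]_n, `|v| <= C * gram_norm v.
Proof.
have uG : G \in unitmx.
  rewrite -row_free_unit; apply: inj_row_free => v vG0; apply/eqP; apply: contraT => v0.
  by have := G_pos v0; rewrite /gram_inner vG0 mul0mx mxE ltxx.
pose w j : 'rV[R]_n := (invmx G *m delta_mx j (0 : 'I_1))^T.
have vw (v : 'rV[R]_n) j : v 0 j = B v (w j).
  by rewrite /B /gram_inner trmxK mulmxA mulmxK// -colE mxE.
exists (1 + \sum_(j < n) gram_norm (w j)).
  by rewrite ltr_wpDr// sumr_ge0// => j _; exact: gram_norm_ge0.
have S0 : 0 <= 1 + \sum_(j < n) gram_norm (w j).
  by rewrite addr_ge0// sumr_ge0// => j _; exact: gram_norm_ge0.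
move=> v; apply: row_norm_leP => [|i j]; first by rewrite mulr_ge0// gram_norm_ge0.
rewrite ord1; have vj : `|v 0 j| <= gram_norm v * gram_norm (w j).
  rewrite ler_norml; apply/andP; split; last first.
    by rewrite vw; exact: gram_Cauchy_Schwarz.
  rewrite lerNl; have := gram_Cauchy_Schwarz (- v) (w j).
  by rewrite -scaleN1r gram_normZ normrN1 mul1r -/B BZl mulN1r -vw.
apply: le_trans vj _; rewrite mulrC ler_wpM2r ?gram_norm_ge0//.
rewrite (bigD1 j)//= addrCA lerDl addr_ge0// sumr_ge0// => k _.
exact: gram_norm_ge0.
Qed.

End inner_product_norm.

(** * Lengths of curves and lower bounds for the distance *)

Section riemannian_distance.
Variables (R : realType) (n : nat) (M : metric_manifold R n).
Implicit Types (c : R -> M) (x : M) (i : chart_index M).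

Lemma velocity_chart c t i : C1_curve c -> chart_dom i (c t) ->
  coord_change i (chart_at (c t)) (c t) ('D_1 (chart i \o c) t) = velocity c t.
Proof.
move=> [cc dc] di.
have dci : is_derive t 1 (chart i \o c) ('D_1 (chart i \o c) t).
  by split=> //; exact: (Ck_on_derivable (dc i)).
have [_ H] := is_derive_chart (smooth_id M) (cc t) di (chart_atP (c t)) dci.
exact: esym H.
Qed.

Lemma speed_sqr_chart c t i : C1_curve c -> chart_dom i (c t) ->
  inner (c t) (velocity c t) (velocity c t) =
  gram_local (@gram R n M) i ('D_1 (chart i \o c) t) ('D_1 (chart i \o c) t)
    (chart i (c t)).
Proof.
move=> cC1 di; have E := velocity_chart cC1 di.
exact (esym (etrans (gram_localE _ _ di) (f_equal2 (inner (c t)) E E))).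
Qed.

Lemma curve_dom_open c i : continuous c -> open (c @^-1` chart_dom i).
Proof. by move=> cc; apply: open_comp => [t _|]; [exact: cc|exact: chart_dom_open]. Qed.

(** [speed] reads the velocity in the preferred chart of [c s], which may jump with [s]. Near [t] it
    is therefore rewritten in the single chart [i], where it is the square root of a continuous
    function. *)
Lemma speed_continuous c : C1_curve c -> continuous (speed c).
Proof.
move=> cC1 t; have [cc dc] := cC1; pose i := chart_at (c t).
have oU := curve_dom_open (i := i) cc.
have di : chart_dom i (c t) by exact: chart_atP.
pose w s := 'D_1 (chart i \o c) s.
pose g s := \sum_a \sum_b w s 0 a * w s 0 b *
  gram_local (@gram R n M) i (delta_mx 0 a) (delta_mx 0 b) (chart i (c s)).
have cg : {for t, continuous g}.
  have g0 : Ck_on 0 (c @^-1` chart_dom i) g.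
    have w0 a : Ck_on 0 (c @^-1` chart_dom i) (fun s => w s 0 a).
      by apply: Ck_on_coord => //; exact: Ck_on_derive (dc i).
    apply: Ck_on_sum => // a; apply: Ck_on_sum => // b.
    apply: Ck_onM => //; first exact: Ck_onM.
    apply: (@Ck_on_comp _ _ _ 0 _ (chart i @` chart_dom i) (chart i \o c)).
    - exact: oU.
    - exact: chart_image_open.
    - by move=> s ds; exists (c s).
    - exact: Ck_onW.
    - exact: (@gram_smooth R n M i _ _ 0%N).
  exact: Ck_on_continuous g0 di.
have E : \forall s \near t, speed c s = Num.sqrt (g s).
  apply: (near_open oU di) => s ds.
  rewrite /speed (speed_sqr_chart cC1 ds) gram_local_sum//.
have ct : {for t, continuous (fun s => Num.sqrt (g s))}.
  by apply: continuous_comp => //; exact: sqrt_continuous.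
rewrite /continuous_at (nbhs_singleton E); apply: cvg_trans ct.
by apply: near_eq_cvg; apply: filterS E => s ->.
Qed.

Lemma speed_ge0 c t : 0 <= speed c t.
Proof. exact: sqrtr_ge0. Qed.

Lemma is_derive_small (E : normedModType R) (u : R -> E) (s : R) (w : E) (e : R) :
  is_derive s 1 u w -> 0 < e -> exists2 d : R, 0 < d &
    forall s', `|s - s'| < d -> `|u s' - u s - (s' - s) *: w| <= e * `|s' - s|.
Proof.
move=> [du <-] e0; move/derivable_nbhsP/eqaddoP : du => /(_ e e0) /near_norm_ball[d d0 H].
exists d => // s' ss'.
have := H (s' - s); rewrite sub0r normrN distrC => /(_ ss').
rewrite -[X in `|X| <= _ -> _]/(u ((s' - s) *: 1 + s) - (u s + (s' - s) *: 'D_1 u s)).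
by rewrite [(s' - s) *: 1]mulr1 subrK opprD addrA.
Qed.

(* A function whose growth along curves is infinitesimally at most [K] times
   the speed is [K]-Lipschitz for the length of curves. *)
Lemma curve_length_lower (f : M -> R) (K : R) c a b :
  0 < K -> continuous f -> C1_curve c -> a <= b ->
  (forall s e, 0 < e -> exists2 d : R, 0 < d & forall s', s < s' -> s' < s + d ->
     f (c s') - f (c s) <= (K * speed c s + e) * (s' - s)) ->
  f (c b) - f (c a) <= K * curve_length c a b.
Proof.
move=> K0 cf cC1 ab H; have sc := speed_continuous cC1.
have [F dF FE] := continuous_antiderivative ab sc.
pose g s := f (c s) - K * F s.
have : g b <= g a.
  apply: dini_nonincreasing ab _ _ => [s sI|s e sa sb e0].
    have cF : {for s, continuous F}.
      apply: differentiable_continuous; apply/derivable1_diffP.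
      by have [] := dF s sI.
    apply: cvgB; last by apply: cvgMr; exact: cF.
    by apply: (@continuous_comp _ _ _ c f); [case: cC1 => + _; exact|exact: cf].
  have sI : a <= s <= b by rewrite sa ltW.
  (* Half of [e] is spent on the growth of [f] and half on the primitive [F]; the latter is divided
     by [K], the factor with which [F] enters [g]. *)
  have e2 : 0 < e / 2 by rewrite divr_gt0.
  have eK : 0 < e / 2 / K by rewrite divr_gt0.
  have [d1 d10 H1] := H s _ e2.
  have [d2 d20 H2] := is_derive_small (dF s sI) eK.
  exists (Num.min d1 d2); first by rewrite lt_min d10.
  move=> s' ss' s'd; have sd1 : s' < s + d1.
    by apply: lt_le_trans s'd _; rewrite lerD2l ge_min lexx.
  have sd2 : `|s - s'| < d2.
    rewrite distrC gtr0_norm ?subr_gt0// ltrBlDl.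
    by apply: lt_le_trans s'd _; rewrite lerD2l ge_min lexx orbT.
  have := H2 s' sd2; rewrite (@gtr0_norm _ (s' - s)) ?subr_gt0// ler_norml => /andP[A _].
  have B := H1 s' ss' sd1.
  have {}A : K * ((s' - s) * speed c s - (F s' - F s)) <= K * (e / 2 / K * (s' - s)).
    by rewrite ler_pM2l//; move: A; rewrite /GRing.scale /=; lra.
  have E : K * (e / 2 / K * (s' - s)) = e / 2 * (s' - s).
    by field; rewrite gt_eqF.
  rewrite E in A; rewrite /g; move: A B; nra.
rewrite /curve_length FE /g; lra.
Qed.

Lemma joined_lower (f : M -> R) (K : R) x y l :
  (forall c a b, C1_curve c -> a <= b -> f (c b) - f (c a) <= K * curve_length c a b) ->
  joined x y l -> f y - f x <= K * l.
Proof.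
move=> H; elim=> [|c a b l' cC1 ab _ IH]; first by rewrite subrr mulr0.
by have := H c a b cC1 ab; rewrite mulrDr; move: IH; lra.
Qed.

Lemma curve_length_ge0 c a b : 0 <= curve_length c a b.
Proof. by apply: Rintegral_ge0 => t _; exact: speed_ge0. Qed.

Lemma joined_ge0 x y l : joined x y l -> 0 <= l.
Proof.
by elim=> [//|c a b l' _ _ _ IH]; rewrite addr_ge0// curve_length_ge0.
Qed.

Lemma riem_dist_le x y l : joined x y l -> riem_dist x y <= l.
Proof.
move=> J; apply: ge_inf => //; exists 0 => l' /=; exact: joined_ge0.
Qed.

(** The path of length [l] makes the set of lengths nonempty; on the empty set [inf] is a mere
    default value. *)
Lemma riem_dist_lower (f : M -> R) (K : R) x y l : 0 < K ->
  (forall c a b, C1_curve c -> a <= b -> f (c b) - f (c a) <= K * curve_length c a b) ->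
  joined x y l -> f y - f x <= K * riem_dist x y.
Proof.
move=> K0 H J; rewrite mulrC -ler_pdivrMr//; apply: lb_le_inf; first by exists l.
by move=> l' /= J'; rewrite ler_pdivrMr// mulrC; exact: joined_lower J'.
Qed.

Lemma continuous_subr (F : normedModType R) (y0 : F) : continuous (fun y => y - y0).
Proof. by move=> y; apply: cvgB; [exact: cvg_id|exact: cvg_cst]. Qed.

Section barrier.
Variable x0 : M.
Let k := chart_at x0.
Let y0 := chart k x0.
Let N := gram_norm (gram x0).

Let gsym := gram_sym x0.
Let gpos := @gram_pos R n M x0.

Lemma gram_norm_near (K : R) : 1 < K ->
  \forall y \near y0, (chart k @` chart_dom k) y /\
    forall w, N w <= K * Num.sqrt (gram_local (@gram R n M) k w w y).
Proof.
move=> K1; have K0 : 0 < K by exact: lt_trans K1.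
have [C C0 HC] := norm_le_gram_norm gsym gpos.
have dk : chart_dom k x0 by exact: chart_atP.
have ky0 : (chart k @` chart_dom k) y0 by exact: chart_image.
pose g a b := gram_local (@gram R n M) k (delta_mx 0 a) (delta_mx 0 b).
(* A relative error [e'] on [N w ^+ 2] gives exactly [K ^- 2 * N w ^+ 2 <= Q]. The bound [eta] on
   each coefficient is such that the [n ^ 2] terms of the quadratic form add up to at most this
   error; its 1 covers [n = 0]. *)
pose e' := 1 - K ^- 2.
have K2 : 1 < K ^+ 2 by rewrite exprn_egt1.
have e'0 : 0 < e' by rewrite subr_gt0 invf_lt1// exprn_gt0.
pose eta := e' / ((n%:R ^+ 2 + 1) * C ^+ 2).
have eta0 : 0 < eta.
  by rewrite divr_gt0// mulr_gt0 ?exprn_gt0// ltr_wpDl// exprn_ge0.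
have nearg : \forall y \near y0, forall ab : 'I_n * 'I_n,
    `|g ab.1 ab.2 y0 - g ab.1 ab.2 y| < eta.
  apply: near_forall => -[a b] /=.
  have cg : g a b y @[y --> y0] --> g a b y0.
    exact: Ck_on_continuous (@gram_smooth R n M k _ _ 0%N) ky0.
  by move/cvgrPdist_lt : cg => /(_ _ eta0).
have neark := open_nbhs_nbhs (conj (@chart_image_open _ _ M k) ky0).
apply: filterS (filterI neark nearg) => y [ky gy]; split=> // w.
have Q0 : gram_local (@gram R n M) k w w y0 = N w ^+ 2.
  by rewrite gram_norm_sqr// gram_localE// !coord_change_id.
set Q := gram_local _ k w w y.
have diffQ : `|N w ^+ 2 - Q| <= e' * N w ^+ 2.
  rewrite -[X in `|X - _|]Q0 /Q !gram_local_sum// -sumrB.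
  apply: le_trans (ler_norm_sum _ _ _) _.
  apply: (@le_trans _ _ (\sum_(a < n) \sum_(b < n) `|w| ^+ 2 * eta)).
    apply: ler_sum => a _; rewrite -sumrB; apply: le_trans (ler_norm_sum _ _ _) _.
    apply: ler_sum => b _; rewrite -mulrBr normrM; apply: ler_pM => //.
      by rewrite normrM expr2 ler_pM// row_norm_le.
    exact/ltW/(gy (a, b)).
  rewrite !sumr_const !card_ord -mulrnA -mulr_natl natrM -expr2.
  apply: (@le_trans _ _ (n%:R ^+ 2 * ((C * N w) ^+ 2 * eta))).
    apply: ler_wpM2l; first exact: exprn_ge0.
    apply: ler_wpM2r; first exact: ltW.
    by rewrite ler_pXn2r ?nnegrE ?mulr_ge0 ?gram_norm_ge0 ?(ltW C0).
  rewrite /eta exprMn.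
  have n20 : 0 <= n%:R ^+ 2 :> R by exact: exprn_ge0.
  have -> : n%:R ^+ 2 * (C ^+ 2 * N w ^+ 2 * (e' / ((n%:R ^+ 2 + 1) * C ^+ 2))) =
      (n%:R ^+ 2 / (n%:R ^+ 2 + 1)) * (e' * N w ^+ 2).
    field; rewrite (gt_eqF C0) andbT.
    by rewrite gt_eqF// ltr_wpDl.
  rewrite ler_piMl//; first by rewrite mulr_ge0 ?exprn_ge0 ?gram_norm_ge0// ltW.
  by rewrite ler_pdivrMr ?ltr_wpDl// mul1r lerDl.
have {diffQ} : N w ^+ 2 <= K ^+ 2 * Q.
  have : K ^- 2 * N w ^+ 2 <= Q.
    by move: diffQ; rewrite ler_norml /e' => /andP[_]; lra.
  by rewrite ler_pdivrMl// exprn_gt0.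
move=> NQ; have Q_ge0 : 0 <= Q.
  have : 0 <= K ^+ 2 * Q by apply: le_trans NQ; exact: exprn_ge0 (gram_norm_ge0 _ _).
  by rewrite pmulr_rge0// exprn_gt0.
rewrite -(ler_pXn2r (n := 2)) ?nnegrE ?gram_norm_ge0 ?mulr_ge0 ?sqrtr_ge0 ?(ltW K0)//.
by rewrite exprMn (sqr_sqrtr Q_ge0); exact: NQ.
Qed.

(* The distance to [x0] for the flat metric frozen at [x0], cut off at [r]: it is
   [K]-Lipschitz along curves and bounds the Riemannian distance from below. *)
Definition barrier (r : R) (z : M) : R :=
  if `[< chart_dom k z >] then Num.min (N (chart k z - y0)) r else r.

Lemma gram_norm_continuous : continuous N.
Proof.
have [C C0 HC] := gram_norm_le gsym gpos.
suff cv (v : 'rV[R]_n) : N u @[u --> v] --> N v by move=> v; exact: cv.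
apply: ((@cvgrPdist_le _ _ _ (nbhs v) _ N (N v)).2) => e e0.
apply: (@near_of_ball _ _ v (fun w => `|N v - N w| <= e) (e / C)).
  exact: divr_gt0.
move=> w vw.
have B u u' : N u - N u' <= C * `|u - u'|.
  rewrite lerBlDr; apply: le_trans (_ : N (u - u') + N u' <= _).
    by rewrite -{1}(subrK u' u); exact: gram_normD.
  by rewrite lerD2r.
have Cvw : C * `|v - w| <= e by rewrite mulrC -ler_pdivlMr// ltW.
rewrite ler_norml; have := B v w; have := B w v; rewrite (distrC w v); lra.
Qed.

Lemma barrier_center r : 0 < r -> barrier r x0 = 0.
Proof.
move=> r0; rewrite /barrier; case: asboolP => [_|[]]; last exact: chart_atP.
by rewrite subrr /N gram_norm0 min_l// ltW.
Qed.

Lemma barrier_le r z : barrier r z <= r.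
Proof. by rewrite /barrier; case: asboolP => _ //; rewrite ge_min lexx orbT. Qed.

Lemma barrier_eq r z : chart_dom k z -> N (chart k z - y0) < r ->
  barrier r z = N (chart k z - y0).
Proof. by move=> dz zr; rewrite /barrier; case: asboolP => // _; rewrite min_l// ltW. Qed.

(** The closed ball of radius [r] is compact and contained in the image of the chart, so it
    corresponds to a closed subset of the Hausdorff space [M]. A point outside the chart domain
    avoids this subset, and around it the barrier is constantly [r]. *)
Lemma barrier_continuous r :
  (forall y, N (y - y0) <= r -> (chart k @` chart_dom k) y) -> continuous (barrier r).
Proof.
move=> rk z; have [dz|ndz] := pselect (chart_dom k z).
  have E : \forall z' \near z, barrier r z' = Num.min (N (chart k z' - y0)) r.
    apply: (near_open (@chart_dom_open _ _ M k) dz) => z' dz'.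
    by rewrite /barrier; case: asboolP.
  have cm : {for z, continuous (fun z' => Num.min (N (chart k z' - y0)) r)}.
    apply: continuous_min; last exact: cvg_cst.
    apply: (@continuous_comp _ _ _ (fun z' => chart k z' - y0) N); last exact: gram_norm_continuous.
    apply: cvgB; last exact: cvg_cst.
    exact: chart_continuous.
  rewrite /continuous_at (nbhs_singleton E); apply: cvg_trans cm.
  by apply: near_eq_cvg; apply: filterS E => z' ->.
pose B := [set y | N (y - y0) <= r].
have [C C0 HC] := norm_le_gram_norm gsym gpos.
have cB : compact B.
  apply: bounded_closed_compact.
    exists (C * r + `|y0|); split; first exact: num_real.
    move=> t rt y /= By; apply: le_trans (ltW rt).
    rewrite -[y in leLHS](subrK y0); apply: le_trans (ler_normD _ _) _.
    by rewrite lerD2r; apply: le_trans (HC _) _; rewrite ler_pM2l.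
  apply: (@preimage_closed _ _ (fun y : 'rV[R]_n => N (y - y0)) [set s : R | s <= r]);
    last exact: closed_le.
  move=> y _; apply: (@continuous_comp _ _ _ (fun y : 'rV[R]_n => y - y0) N);
    last exact: gram_norm_continuous.
  exact: continuous_subr.
have cBM : closed (chart_inv k @` B).
  apply: compact_closed; first exact: manifold_hausdorff.
  apply: continuous_compact => //; apply: continuous_in_subspaceT => y /[!inE] By.
  by apply: chart_inv_continuous; exact: rk.
have nz : ~ (chart_inv k @` B) z.
  by move=> [y By yz]; apply: ndz; rewrite -yz; apply: chart_inv_dom; exact: rk.
have E : \forall z' \near z, barrier r z' = r.
  apply: (near_open (closed_openC cBM) nz) => z' nz'.
  rewrite /barrier; case: asboolP => // dz'; rewrite min_r// leNgt; apply/negP => lt.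
  by apply: nz'; exists (chart k z'); [exact: ltW|rewrite chartK].
rewrite /continuous_at (nbhs_singleton E).
exact: cvg_near_cst E.
Qed.

Lemma barrier_growth (K r : R) c : 1 < K -> C1_curve c ->
  (forall y, N (y - y0) <= r ->
    forall w, N w <= K * Num.sqrt (gram_local (@gram R n M) k w w y)) ->
  forall s e, 0 < e -> exists2 d : R, 0 < d & forall s', s < s' -> s' < s + d ->
     barrier r (c s') - barrier r (c s) <= (K * speed c s + e) * (s' - s).
Proof.
move=> K1 cC1 HK s e e0; have K0 : 0 < K by exact: lt_trans K1.
have [[ds sr]|ns] := pselect (chart_dom k (c s) /\ N (chart k (c s) - y0) < r); last first.
  have rs : barrier r (c s) = r.
    rewrite /barrier; case: asboolP => // ds; rewrite min_r// leNgt; apply/negP => lt.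
    by apply: ns.
  exists 1 => // s' ss' _; apply: (@le_trans _ _ 0); first by rewrite rs subr_le0 barrier_le.
  by rewrite mulr_ge0 ?subr_ge0 ?ltW// ltr_wpDl// mulr_ge0 ?speed_ge0// ltW.
have [cc dc] := cC1.
pose u := chart k \o c; pose w := 'D_1 u s.
have du : is_derive s 1 u w by split=> //; exact: (Ck_on_derivable (dc k)).
have [C C0 HC] := gram_norm_le gsym gpos.
have eC : 0 < e / C by exact: divr_gt0.
have [d1 d10 H1] := is_derive_small du eC.
have nd : \forall s' \near s, chart_dom k (c s').
  by apply: (near_open (curve_dom_open (i := k) cc) ds).
have [d2 d20 H2] := near_norm_ball nd.
exists (Num.min d1 d2); first by rewrite lt_min d10.
move=> s' ss' s'd.
have ssd : `|s - s'| < Num.min d1 d2 by rewrite distrC gtr0_norm ?subr_gt0// ltrBlDl.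
move: ssd; rewrite lt_min => /andP[/H1 A /H2 ds'].
rewrite (barrier_eq ds sr).
have Nw : N w <= K * speed c s.
  by rewrite /speed (speed_sqr_chart cC1 ds); apply: HK; exact: ltW.
have B1 : barrier r (c s') <= N (u s' - y0).
  by rewrite /barrier; case: asboolP => // _; rewrite ge_min lexx.
have B2 : N (u s' - y0) <= N (u s - y0) + N (u s' - u s).
  by rewrite -(subrKA (u s)) addrC; exact: gram_normD.
have B3 : N (u s' - u s) <= N ((s' - s) *: w) + N (u s' - u s - (s' - s) *: w).
  by rewrite -{1}(subrK ((s' - s) *: w) (u s' - u s)) addrC; exact: gram_normD.
have ss0 : 0 < s' - s by rewrite subr_gt0.
rewrite (gtr0_norm ss0) in A.
have B4 : N ((s' - s) *: w) <= (s' - s) * (K * speed c s).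
  by rewrite /N gram_normZ// gtr0_norm// ler_pM2l.
have B5 : N (u s' - u s - (s' - s) *: w) <= e * (s' - s).
  apply: le_trans (HC _) _; rewrite -ler_pdivlMl// mulrA [C^-1 * e]mulrC.
  exact: A.
rewrite -/(u s); move: B1 B2 B3 B4 B5; lra.
Qed.

Lemma riem_dist_center (K : R) : 1 < K -> exists2 r : R, 0 < r &
  (forall y l, joined x0 y l -> barrier r y <= K * riem_dist x0 y).
Proof.
move=> K1; have K0 : 0 < K by exact: lt_trans K1.
have [d d0 H] := near_norm_ball (gram_norm_near K1).
have [C C0 HC] := norm_le_gram_norm gsym gpos.
(* Since the coordinate norm is at most [C] times [N], the ball of radius [r] for [N] lies within
   [d / 2] of [y0]. *)
pose r := d / C / 2.
have r0 : 0 < r by rewrite divr_gt0// divr_gt0.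
have Hr y : N (y - y0) <= r -> `|y0 - y| < d.
  move=> yr; rewrite distrC; apply: le_lt_trans (HC _) _.
  apply: le_lt_trans (_ : C * r < d); first by rewrite ler_pM2l.
  rewrite /r (_ : C * _ = d / 2); last by field; rewrite gt_eqF.
  by rewrite ltr_pdivrMr// ltr_pMr// ltr1n.
exists r => // y l J.
have := @riem_dist_lower (barrier r) K x0 y l K0 _ J.
rewrite barrier_center// subr0; apply=> c a b cC1 ab.
apply: curve_length_lower => //.
  by apply: barrier_continuous => y' /Hr/H[].
by apply: barrier_growth => // y' /Hr/H[].
Qed.

End barrier.

End riemannian_distance.

(** * Orbits of the circle *)

(** Serves twice: with [f] a time map of the flow itself, which makes the speed constant along an
    orbit, and with [f] the quotient map, which transports the length of the field to the
    quotient. *)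
Lemma flow_field_push (R : realType) (m n : nat) (M : smooth_manifold R m)
    (N : smooth_manifold R n) (a : R -> M -> M) (b : R -> N -> N) (f : M -> N) x :
  smooth_map f -> (forall x, a 0 x = x) -> (forall t, b t (f x) = f (a t x)) ->
  {for 0, continuous (a^~ x)} ->
  derivable (fun t => chart (chart_at x) (a t x)) 0 1 ->
  flow_field b (f x) = tangent_map f x (flow_field a x).
Proof.
move=> sf a0 bf ca da.
have d0 : is_derive (0 : R) (1 : R) (chart (chart_at x) \o a^~ x) (flow_field a x).
  by split=> //; exact: da.
have di : chart_dom (chart_at x) (a 0 x) by rewrite a0; exact: chart_atP.
have dj : chart_dom (chart_at (f x)) (f (a 0 x)) by rewrite a0; exact: chart_atP.
have [_ H] := is_derive_chart sf ca di dj d0.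
have E : (fun t : R => chart (chart_at (f x)) (b t (f x))) = chart (chart_at (f x)) \o f \o a^~ x.
  by apply: funext => t; rewrite /= bf.
by rewrite {1}/flow_field E H a0.
Qed.

Lemma curve_length_cst (R : realType) n (M : metric_manifold R n) (c : R -> M) L s t :
  s <= t -> (forall u, speed c u = L) -> curve_length c s t = (t - s) * L.
Proof.
move=> st cL; rewrite /curve_length.
have -> : speed c = cst L by apply: funext => u; exact: cL.
rewrite Rintegral_cst; last exact: measurable_itv.
rewrite mulrC; congr (_ * _).
have E := @lebesgue_measure_itv R `[s, t]; rewrite /= lte_fin in E.
by etransitivity; [exact (f_equal fine E)|case: ltgtP st => //= -> _; rewrite subrr].
Qed.

Lemma integral_curve_velocity (R : realType) n (M : smooth_manifold R n)
    (X : M -> 'rV[R]_n) c t :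
  integral_curve X c -> velocity c t = X (c t).
Proof. move=> [_ H]; exact: (@derive_val _ _ _ _ _ _ _ (H t)). Qed.

Section orbits.
Variables (R : realType) (m : nat) (M : metric_manifold R m) (a : R -> M -> M).
Hypothesis a0 : forall x, a 0 x = x.
Hypothesis aD : forall s t x, a (s + t) x = a s (a t x).
Hypothesis a_smooth : smooth_family a.
Hypothesis a_isometry : forall t, local_isometry (a t).

Let X := flow_field a.

Lemma orbit_continuous x : continuous (a^~ x).
Proof.
move=> t; apply: (@continuous_pair1 _ _ _ (fun z : R * M => a z.1 z.2)).
by case: a_smooth => + _; exact.
Qed.

Lemma orbit_C1 x : C1_curve (a^~ x).
Proof.
split=> [|i]; first exact: orbit_continuous.
have dk := chart_atP x.
have S := Ck_on_slice1 (chart (chart_at x) x) (a_smooth.2 (chart_at x) i 1%N).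
have E : chart i \o a^~ x = fun t => chart i (a t (chart_inv (chart_at x) (chart (chart_at x) x))).
  by apply/funext => t; rewrite chartK.
rewrite E; apply: Ck_on_sub S => t ti; by exists x.
Qed.

Lemma orbit_derivable x i : chart_dom i x -> derivable (fun t => chart i (a t x)) 0 1.
Proof.
move=> di; have [_ H] := orbit_C1 x.
by apply: (Ck_on_derivable (H i)); rewrite /preimage /= a0.
Qed.

Lemma orbit_velocity x t : velocity (a^~ x) t = X (a t x).
Proof.
apply: integral_curve_velocity.
exact: flow_integral_curve a0 aD orbit_continuous orbit_derivable x.
Qed.

Lemma orbit_speed x t : speed (a^~ x) t = Num.sqrt (inner x (X x) (X x)).
Proof.
rewrite /speed orbit_velocity.
have -> : X (a t x) = tangent_map (a t) x (X x).
  apply: flow_field_push => //; first by case: (a_isometry t).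
  - by move=> s; rewrite -!aD addrC.
  - exact: orbit_continuous.
  - exact: orbit_derivable (chart_atP x).
by rewrite (a_isometry t).2.
Qed.

Lemma orbit_length x s t : s <= t ->
  curve_length (a^~ x) s t = (t - s) * Num.sqrt (inner x (X x) (X x)).
Proof.
move=> st; exact (curve_length_cst st (orbit_speed x)).
Qed.

Lemma orbit_joined x t : 0 <= t ->
  joined x (a t x) (t * Num.sqrt (inner x (X x) (X x))).
Proof.
move=> t0; rewrite -[t in t * _]subr0 -orbit_length// -[curve_length _ _ _]add0r.
apply: joined_step; [exact: orbit_C1|exact: t0|].
by rewrite a0; exact: joined_refl.
Qed.

(** To first order the orbit moves by [t *: X x] in the chart, so its frozen norm is at least [t]
    times the speed less [e]. The time is below [d1] for this estimate, below [d2] to stay in the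
    chart, and below [r / (L + 1)] to stay under the cut-off. *)
Lemma orbit_barrier x (r e : R) : 0 < r -> 0 < e -> exists2 t, 0 < t &
  t * (Num.sqrt (inner x (X x) (X x)) - e) <= barrier x r (a t x).
Proof.
move=> r0 e0; set k := chart_at x.
have [C C0 HC] := gram_norm_le (gram_sym x) (@gram_pos _ _ M x).
have du : is_derive (0 : R) (1 : R) (fun t => chart k (a t x)) (X x).
  by split=> //; exact: orbit_derivable (chart_atP x).
have [d1 d10 H1] := is_derive_small du (divr_gt0 e0 C0).
have nk : \forall t \near (0 : R), chart_dom k (a t x).
  apply: (@near_open R (a^~ x @^-1` chart_dom k)) => //.
    by apply: curve_dom_open; exact: orbit_continuous.
  by rewrite /preimage /= a0; exact: chart_atP.
have [d2 d20 H2] := near_norm_ball nk.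
pose L := Num.sqrt (inner x (X x) (X x)).
have L0 : 0 <= L by exact: sqrtr_ge0.
pose t := Num.min (Num.min d1 d2) (r / (L + 1)) / 2.
have t0 : 0 < t by rewrite divr_gt0// !lt_min d10 d20 divr_gt0// ltr_wpDl.
have : t < Num.min (Num.min d1 d2) (r / (L + 1)).
  by rewrite ltr_pdivrMr// ltr_pMr ?ltr1n// !lt_min d10 d20 divr_gt0// ltr_wpDl.
rewrite !lt_min => /andP[/andP[td1 td2] tr].
have nt : `|0 - t| = t by rewrite sub0r normrN gtr0_norm.
exists t => //.
have dt : chart_dom k (a t x) by apply: H2; rewrite nt.
rewrite /barrier; case: asboolP => // _.
have tL : t * (L - e) <= r.
  apply: (@le_trans _ _ (t * (L + 1))); first by rewrite ler_pM2l//; move: e0; lra.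
  by rewrite -ler_pdivlMr ?ltr_wpDl// ltW.
rewrite le_min tL andbT.
have := H1 t; rewrite nt => /(_ td1); rewrite a0 subr0 (gtr0_norm t0) => A.
set u := chart k (a t x) - chart k x in A *.
have B1 : gram_norm (gram x) (t *: X x) <= gram_norm (gram x) u +
    gram_norm (gram x) (t *: X x - u).
  by rewrite -{1}(subrK u (t *: X x)) addrC; exact: gram_normD (gram_sym x) (@gram_pos _ _ M x) _ _.
have B2 : gram_norm (gram x) (t *: X x - u) <= e * t.
  apply: le_trans (HC _) _; rewrite -ler_pdivlMl// mulrA [C^-1 * e]mulrC distrC.
  exact: A.
have B3 : gram_norm (gram x) (t *: X x) = t * L.
  by rewrite (gram_normZ (gram_sym x)) (gtr0_norm t0).
by rewrite -/L; move: B1 B2; rewrite B3; lra.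
Qed.

Lemma barrier_le0 (x : M) (r : R) z : 0 < r -> barrier x r z <= 0 -> z = x.
Proof.
move=> r0; rewrite /barrier; case: asboolP => [dz|_]; last by rewrite leNgt r0.
rewrite ge_min [r <= 0]leNgt r0 orbF => N0.
have [C C0 HC] := norm_le_gram_norm (gram_sym x) (@gram_pos _ _ M x).
have : chart (chart_at x) z - chart (chart_at x) x == 0.
  rewrite -normr_le0; apply: le_trans (HC _) _.
  by rewrite pmulr_rle0.
rewrite subr_eq0 => /eqP E.
by rewrite -(chartK dz) E chartK//; exact: chart_atP.
Qed.

Hypothesis displacement : forall t, exists d : R, forall x, riem_dist x (a t x) = d.

(** It suffices to bound any speed by any other. The common displacement is bounded below by the
    barrier at [x'] and above by the length of the orbit arc at [y']; dividing by the time [t]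
    compares the speeds up to the factor [K] and an error [e / 2]. *)
Lemma orbit_speed_cst x y : inner x (X x) (X x) = inner y (X y) (X y).
Proof.
pose L z := Num.sqrt (inner z (X z) (X z)).
suff H x' y' : L x' <= L y'.
  have inner_ge0 (z : M) v : 0 <= inner z v v.
    have [->|v0] := eqVneq v 0; last exact: ltW (gram_pos z v0).
    by rewrite /inner /gram_inner !mul0mx mxE.
  have E : L x = L y by exact (le_anti (introT andP (conj (H x y) (H y x)))).
  have sqrL z : inner z (X z) (X z) = L z ^+ 2 by exact (esym (sqr_sqrtr (inner_ge0 _ _))).
  by etransitivity; [exact (sqrL x)|rewrite E; exact (esym (sqrL y))].
have Ly0 : 0 <= L y' by exact: sqrtr_ge0.
apply/ler_addgt0Pr => e e0.
(* Chosen so that [K * L y' <= L y' + e / 2]; adding 1 to [L y'] allows for a zero speed. *)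
pose K := 1 + (e / 2) / (L y' + 1).
have K1 : 1 < K by rewrite ltrDl divr_gt0 ?ltr_wpDl// divr_gt0.
have K0 : 0 < K by exact: lt_trans K1.
have [r r0 H] := riem_dist_center x' K1.
have e20 : 0 < e / 2 by exact: divr_gt0.
have [t t0 B] := orbit_barrier x' r0 e20.
have : t * (L x' - e / 2) <= K * riem_dist x' (a t x').
  exact (le_trans B (H _ _ (orbit_joined x' (ltW t0)))).
have [d dE] := displacement t; rewrite dE -(dE y').
have D1 : riem_dist y' (a t y') <= t * L y' by exact (riem_dist_le (orbit_joined y' (ltW t0))).
move=> D2.
have : t * (L x' - e / 2) <= t * (K * L y').
  by apply: le_trans D2 _; rewrite mulrCA ler_pM2l.
rewrite ler_pM2l// => D3.
suff : K * L y' <= L y' + e / 2.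
  move: D3; clear; move: (L x') (L y') (K * _) => u v w; lra.
rewrite /K mulrDl mul1r lerD2l -mulrA; apply: ler_piMr; first exact: ltW.
by rewrite mulrC ler_pdivrMr ?ltr_wpDl// mul1r lerDl.
Qed.

Hypothesis a_free : circle_free a.

(** If the field vanished at [x], the half-turn arc would have length 0 and the barrier would force
    [a (1/2) x = x], although 1/2 is not an integer. Any constant above 1 would do in place of 2. *)
Lemma orbit_speed_gt0 x : 0 < inner x (X x) (X x).
Proof.
apply: gram_pos; apply/eqP => X0.
have [r r0 H] := @riem_dist_center _ _ M x 2 (ltr1n _ _).
pose t : R := 2^-1; have t0 : 0 <= t by rewrite invr_ge0.
have J := orbit_joined x t0.
have : barrier x r (a t x) <= 0.
  apply: le_trans (H _ _ J) _; rewrite pmulr_rle0//; apply: le_trans (riem_dist_le J) _.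
  by rewrite X0 /inner /gram_inner !mul0mx mxE sqrtr0 mulr0.
move=> /(barrier_le0 r0)/a_free[k tk].
have k0 : 0 < k by rewrite -(ltr0z R) -tk invr_gt0.
have : k < 1 by rewrite -(ltrz1 R) -tk invf_lt1// ltr1n.
by rewrite ltNge -gtz0_ge1 k0.
Qed.

End orbits.

Lemma integral_curve_length (R : realType) n (M : metric_manifold R n)
    (X : M -> 'rV[R]_n) c l t :
  integral_curve X c -> (forall x, inner x (X x) (X x) = l) -> 0 <= t ->
  curve_length c 0 t = t * Num.sqrt l.
Proof.
move=> ic Xl t0; rewrite -[t in RHS]subr0; apply: curve_length_cst => // u.
by rewrite /speed (integral_curve_velocity u ic) Xl.
Qed.

(** Euclidean division: the remainder of [t] by [l] is a return time in [[0, l)], hence 0 by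
    minimality of [l]. *)
Lemma flow_return_multiple (R : realType) (T : Type) (b : R -> T -> T) y l t :
  (forall y, b 0 y = y) -> (forall s t y, b (s + t) y = b s (b t y)) ->
  least_period (b^~ y) l -> b t y = y -> exists j : int, t = j%:~R * l.
Proof.
move=> b0 bD [[l0 pl] ml] bt.
have bl : b l y = y by have := pl 0; rewrite add0r b0.
have blN (n : nat) : b (n%:R * l) y = y.
  elim: n => [|n IH]; first by rewrite mul0r b0.
  by rewrite -natr1 mulrDl mul1r bD bl.
have blZ (j : int) : b (j%:~R * l) y = y.
  case: j => n; first exact: blN.
  rewrite NegzE mulrNz mulNr -[in LHS](blN n.+1).
  by rewrite -bD addNr b0.
exists (Num.floor (t / l)).
set j := Num.floor _.
have jt : j%:~R * l <= t by rewrite -ler_pdivlMr// floor_le.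
have tj : t - j%:~R * l < l.
  by rewrite ltrBlDl -[X in _ + X]mul1r -mulrDl -ltr_pdivrMr// -(intrD _ j 1) lt_succ_floor.
apply/eqP; rewrite -subr_eq0; apply: contraTT tj => tj0.
rewrite -leNgt; apply: ml; split; first by rewrite lt0r tj0 subr_ge0.
move=> s; rewrite bD; congr b.
by rewrite addrC bD bt -mulNr -mulrNz blZ.
Qed.

(** * Coincidences between the circle and the finite group *)

Section coincidences.
Variables (R : realType) (m : nat) (M : smooth_manifold R m) (a : R -> M -> M).
Hypothesis a0 : forall x, a 0 x = x.
Hypothesis aD : forall s t x, a (s + t) x = a s (a t x).
Hypothesis a1 : forall x, a 1 x = x.
Hypothesis a_free : circle_free a.
Variables (gT : finGroupType) (to : {action gT &-> M}).
Hypothesis commute : forall t g x, a t (to x g) = to (a t x) g.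

Let G := #|gT|.

Let G0 : 0 < G%:R :> R.
Proof. by rewrite ltr0n /G -cardsT cardG_gt0. Qed.

Let expgG (g : gT) : (g ^+ G = 1)%g.
Proof.
have /dvdnP[k E] := cardSg (finset.subsetT <[g]>%g).
by rewrite /G -cardsT E mulnC expgM -orderE expg_order expg1n.
Qed.

Lemma circle_integer (k : int) x : a k%:~R x = x.
Proof.
have aN (n : nat) : a n%:R x = x.
  by elim: n => [|n IH]; [rewrite a0|rewrite -natr1 addrC aD IH a1].
case: k => n; first exact: aN.
by rewrite NegzE mulrNz -[in LHS](aN n.+1) -aD addNr a0.
Qed.

Lemma coincidence_iter t g x n : a t x = to x g -> a (n%:R * t) x = to x (g ^+ n)%g.
Proof.
move=> E; elim: n => [|n IH]; first by rewrite mul0r a0 expg0 act1_type.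
by rewrite -natr1 mulrDl mul1r aD E commute IH -actM_type -expgSr.
Qed.

(** Iterating the coincidence [G] times gives [a (G%:R * t) x = x] because [g ^+ G = 1]; freeness of
    the circle then makes [G%:R * t] an integer. *)
Lemma coincidence_integer t g x : a t x = to x g -> exists k : int, t = k%:~R / G%:R.
Proof.
move=> /(@coincidence_iter _ _ _ G); rewrite expgG act1_type => /a_free[k kt].
by exists k; rewrite -kt mulrC mulKf// gt_eqF.
Qed.

(** Reduction of the numerator modulo [G] confines the coincidence times to a finite type, so that
    coincidences at a point form a finite set. *)
Lemma coincidence_nat t g x : a t x = to x g -> exists k : 'I_G,
  forall x, a t x = a (k%:R / G%:R) x.
Proof.
move=> /coincidence_integer[z ->].
have Gz : 0 < G%:Z by rewrite -(ltr0z R).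
have kG : (`|(z %% G)%Z| < G)%N.
  by rewrite -ltz_nat gez0_abs ?ltz_pmod// modz_ge0// gt_eqF.
exists (Ordinal kG) => x' /=.
rewrite {1}(divz_eq z G) intrD intrM mulrDl mulfK ?gt_eqF//.
rewrite aD circle_integer; congr (a (_ / _) x').
by rewrite -[in LHS](@gez0_abs (z %% G)%Z)// modz_ge0// gt_eqF.
Qed.

Hypothesis a_smooth : forall t, smooth_map (a t).
Hypothesis to_smooth : forall g, smooth_map (to^~ g).
Hypothesis M_connected : connected [set: M].

(* [x2] minimizes the number of coincidences of the form [a (k / G) x = to x g];
   no new ones appear near [x2], so by minimality none is lost there either. *)
Lemma principal_point : M -> exists x2 : M,
  forall t g, a t x2 = to x2 g -> forall x, a t x = to x g.
Proof.
move=> x0.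
pose A x := [set p : gT * 'I_G | `[< a (p.2%:R / G%:R) x = to x p.1 >]]%SET.
pose P n := `[< exists x, #|A x| = n >].
have exP : exists n, P n by exists #|A x0|; apply/asboolP; exists x0.
have [x2 A2] : exists x2, forall x, (#|A x2| <= #|A x|)%N.
  have [n /asboolP[x2 <-] min] := ex_minnP exP.
  by exists x2 => x; apply: min; apply/asboolP; exists x.
exists x2 => t g E2.
have [k kt] := coincidence_nat E2.
have nA : \forall x \near x2, forall p : gT * 'I_G, p \notin A x2 -> p \notin A x.
  apply: near_forall => p; case: (boolP (p \in A x2)) => [_|pA].
    exact: nearW.
  have cl : closed [set x | a (p.2%:R / G%:R) x = to x p.1].
    apply: closed_eq_fun; first exact: manifold_hausdorff.
      by case: (a_smooth (p.2%:R / G%:R)).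
    by case: (to_smooth p.1).
  apply: (near_open (closed_openC cl)).
    by move=> /= E; move: pA; rewrite inE => /asboolP.
  by move=> x /= xE _; rewrite inE; apply/asboolP.
(* The coincidence becomes the fixed-point equation of [f]. The two actions commute, [g ^+ G = 1]
   and [G%:R * t] is an integer, so [f] has order dividing [G]. *)
pose f x := to (a (- t) x) g.
have sf : smooth_map f by exact: (smooth_map_comp (a_smooth (- t)) (to_smooth g)).
have fE x : f x = x <-> a t x = to x g.
  rewrite /f -commute; split=> [E|<-]; last by rewrite -aD addNr a0.
  by rewrite -[in LHS]E -aD subrr a0.
have fi n x : iter n f x = to (a (- (n%:R * t)) x) (g ^+ n)%g.
  elim: n => [|n IH]; first by rewrite /= mul0r oppr0 a0 expg0 act1_type.
  rewrite iterS IH /f commute -aD -actM_type -expgSr.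
  by rewrite -natr1 mulrDl mul1r opprD addrC.
have fG x : iter G f x = x.
  rewrite fi expgG act1_type; have [z ->] := coincidence_integer E2.
  by rewrite mulrC divfK ?gt_eqF// -mulrNz circle_integer.
have {}nA := nbhs_interior nA.
move=> x; apply/fE; move: x.
have Gn : (0 < G)%N by rewrite -(ltr0n R).
apply: (finite_order_open_fixed M_connected sf Gn fG (@open_interior _ _)).
  by exists x2; exact: nbhs_singleton nA.
move=> x /interior_subset nAx; apply/fE.
have AE : A x = A x2.
  apply/eqP; rewrite eqEcard A2 andbT; apply/fintype.subsetP => p; apply: contraTT.
  exact: nAx.
have : (g, k) \in A x by rewrite AE inE; apply/asboolP => /=; rewrite -kt.
by rewrite inE => /asboolP /=; rewrite -kt.
Qed.

Lemma coincidence_mem (l : R) g (j : int) : (forall x, a l x = to x g) ->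
  exists h, forall x, a (j%:~R * l) x = to x h.
Proof.
move=> E; case: j => n; first by exists (g ^+ n)%g => x; exact: coincidence_iter.
exists (g^-1 ^+ n.+1)%g => x; rewrite NegzE mulrNz mulNr -mulrN; apply: coincidence_iter.
rewrite -[x in RHS]a0 -(addNr l) aD -commute E -actM_type mulgV act1_type.
by [].
Qed.

Variables (Q : Type) (q : M -> Q) (b : R -> Q -> Q).
Hypothesis q_orbits : orbit_projection to q.
Hypothesis bq : forall t x, b t (q x) = q (a t x).

Lemma quotient_return t x : b t (q x) = q x <-> exists g, a t x = to x g.
Proof.
by rewrite bq; split=> [/esym /q_orbits.2//|H]; apply: esym; apply/q_orbits.2.
Qed.

(** Positive return times are positive multiples of [1 / G], and 1 is one of them; the least
    numerator exists by well-ordering. *)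
Lemma quotient_least_period x : exists l, least_period (b^~ (q x)) l.
Proof.
have bD s t y : b (s + t) y = b s (b t y).
  by have [x' <-] := q_orbits.1 y; rewrite !bq aD.
have b0 y : b 0 y = y by have [x' <-] := q_orbits.1 y; rewrite bq a0.
pose P n := (0 < n)%N && `[< b (n%:R / G%:R) (q x) = q x >].
have exP : exists n, P n.
  exists G; apply/andP; split; first by rewrite -(ltr0n R).
  by apply/asboolP; rewrite mulfV ?gt_eqF// bq a1.
have [n /andP[n0 /asboolP bn] min] := ex_minnP exP.
exists (n%:R / G%:R); split.
  by split=> [|t]; [rewrite divr_gt0// ltr0n|rewrite bD bn].
move=> l [l0 pl].
have bl : b l (q x) = q x by have := pl 0; rewrite add0r b0.
have [g /coincidence_integer[[k|k] lE]] := (quotient_return l x).1 bl; last first.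
  by move: l0; rewrite lE NegzE mulrNz mulNr oppr_gt0 ltNge divr_ge0.
rewrite lE ler_pM2r ?invr_gt0// ler_nat; apply: min; apply/andP; split.
  by move: l0; rewrite lE pmulr_lgt0 ?invr_gt0// ltr0n.
by apply/asboolP; rewrite -[k%:R]/(k%:~R) -lE.
Qed.

End coincidences.

Theorem proposition8 (R : realType) (m n : nat)
    (M : riemannian_manifold R m) (M_compact : compact [set: M])
    (a : R -> M -> M) (a_circle : circle_action a) (a_free : circle_free a)
    (a_clifford_wolf : forall t, clifford_wolf (a t))
    (N : riemannian_manifold R n) (p : M -> N)
    (p_orbits : orbit_projection (fun x t => a t x) p)
    (p_submersion : riemannian_submersion p)
    (gT : finGroupType) (to : {action gT &-> M})
    (to_isometry : forall g, riem_isometry (fun x : M => to x g))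
    (to_free : free_action to)
    (Mbar : riemannian_manifold R m) (q : M -> Mbar)
    (q_orbits : orbit_projection to q) (q_local_isometry : local_isometry q)
    (commute : forall t g x, a t (to x g) = to (a t x) g)
    (toN : {action coset_of (circle_part a to) &-> N})
    (toN_induced : forall x g, toN (p x) (coset (circle_part a to) g) = p (to x g))
    (singular : exists y, orbifold_singular toN y) :
  exists X : Mbar -> 'rV[R]_m,
    [/\ killing X, constant_length X & quasiregular X].

Proof.
have [a0 aD a1 a_smooth] := a_circle.
have a_isometry t : local_isometry (a t) by case: (a_clifford_wolf t) => -[].
have displacement t : exists d : R, forall x, riem_dist x (a t x) = d.
  by case: (a_clifford_wolf t).
have to_local g : local_isometry (to^~ g) by case: (to_isometry g).
have [q_surj qE] := q_orbits.
have q_smooth := q_local_isometry.1.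
have q_open : forall O : set M, open O -> open (q @` O).
  apply: (orbit_projection_open (to := to)) => //.
  - by move=> g; case: (to_local g) => -[].
  - by case: q_smooth.
  - exact: manifold_hausdorff.
have q_inj x : exists O : set M, [/\ open O, O x &
    forall x1 x2, O x1 -> O x2 -> q x1 = q x2 -> x1 = x2].
  apply: (orbit_projection_locally_injective (to := to)) => //.
  - by move=> g; case: (to_local g) => -[].
  - exact: manifold_hausdorff.
(* [b] is defined through an arbitrary choice of preimages; commutation makes it independent of this
   choice, which is [bq]. *)
have [s sK] := choice q_surj.
pose b t y := q (a t (s y)).
have bq t x : b t (q x) = q (a t x).
  have [g sE] := (qE x (s (q x))).1 (esym (sK _)).
  rewrite /b sE commute; apply: esym; apply/qE; by exists g.
have b0 := descended_flow0 a0 q_surj bq.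
have bD := descended_flowD aD q_surj bq.
have b_cont := descended_flow_continuous a_smooth q_local_isometry q_surj bq.
have b_der := descended_flow_derivable a0 a_smooth q_local_isometry q_surj bq.
have [X [X_killing orbit_curve [l l0 X_length]]] : exists X : Mbar -> 'rV[R]_m,
    [/\ killing X, forall y, integral_curve X (b^~ y) & constant_length X].
  exists (flow_field b); split.
  - exact: (descended_field_killing a0 a_smooth a_isometry q_local_isometry
      q_surj q_open q_inj bq).
  - exact: flow_integral_curve.
  have [x0 _] := riemannian_nonempty M.
  exists (inner x0 (flow_field a x0) (flow_field a x0)).
    exact: (orbit_speed_gt0 a0 aD a_smooth a_isometry a_free).
  move=> y; have [x <-] := q_surj y.
  have -> : flow_field b (q x) = tangent_map q x (flow_field a x).
    apply: flow_field_push; [exact: q_smooth|exact: a0|by []| |].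
      exact: orbit_continuous.
    by apply: (orbit_derivable a0 a_smooth); exact: chart_atP.
  etransitivity; first exact: q_local_isometry.2.
  exact: (orbit_speed_cst a0 aD a_smooth a_isometry displacement).
(* By uniqueness every integral curve is an orbit of [b], so closedness has to be checked on these
   orbits only. *)
have curve_orbit c : integral_curve X c -> c = b^~ (c 0).
  move=> ic; apply: (integral_curve_unique _ ic (orbit_curve _)); last by rewrite b0.
  by case: X_killing.
have b_length y t : 0 <= t -> curve_length (b^~ y) 0 t = t * Num.sqrt l.
  exact: (integral_curve_length (orbit_curve y) X_length).
have least_b := quotient_least_period a0 aD a1 a_free commute q_orbits bq.
exists X; split; [exact: X_killing|by exists l|].
split.
- by move=> y; exists (b^~ y) => //; exact: b0.
- move=> c /curve_orbit ->; have [x qx] := q_surj (c 0).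
  by have [t [pt _]] := least_b x; exists t; rewrite -qx.
have [x2 principal] : exists x2 : M,
    forall t g, a t x2 = to x2 g -> forall x, a t x = to x g.
  have [x0 _] := riemannian_nonempty M.
  apply: (principal_point a0 aD a1 a_free commute); last exact: x0.
  - by move=> t; case: (a_isometry t).
  - by move=> g; case: (to_local g).
  - exact: riemannian_connected.
(* A nontrivial coset fixing [y] is represented by some [g] outside the circle. For [x1] above [y],
   the point [to x1 g] projects to [y] again, so it lies on the circle orbit of [x1]. *)
have [x1 [g [t [gN gt]]]] : exists (x1 : M) (g : gT) (t : R),
    g \notin circle_part a to /\ to x1 g = a t x1.
  have [y] := singular; rewrite /orbifold_singular.
  have [[C /= C1 Cy]|nC] := pselect (exists2 C, C != 1%g & toN y C = y); last first.
    case/eqP; apply/setP => C; rewrite !inE; apply/asboolP/eqP => [Cy|->].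
      by apply: contra_notP nC => C1; exists C => //; apply/eqP.
    exact: act1_type.
  move=> _; have [x1 px1] := p_orbits.1 y.
  have [g _ CE] := cosetP C; rewrite {}CE in C1 Cy.
  move: Cy; rewrite -px1 toN_induced => /esym /p_orbits.2[t gt].
  exists x1, g, t; split=> //; apply: contra_neqN C1; exact: coset_id.
have [l1 Hl1] := least_b x1; have [l2 Hl2] := least_b x2.
exists (b^~ (q x1)), (b^~ (q x2)), l1, l2; split=> //.
have l1_gt0 : 0 < l1 by case: Hl1 => -[].
have l2_gt0 : 0 < l2 by case: Hl2 => -[].
rewrite !b_length ?ltW//; apply/eqP => E.
have {E} E : l1 = l2 by apply: (mulIf _ E); rewrite gt_eqF// sqrtr_gt0.
move/negP: gN; apply.
(* The return at time [l2] is a coincidence at [x2], which [principal] spreads to all of [M]; with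
   [l1 = l2], the time [t] is a multiple of it. *)
have [h hE] : exists h, a l2 x2 = to x2 h.
  apply: (quotient_return q_orbits bq l2 x2).1.
  by have [[_ pl] _] := Hl2; have := pl 0; rewrite add0r b0.
have [j tE] : exists j : int, t = j%:~R * l1.
  apply: (flow_return_multiple b0 bD Hl1).
  by apply/(quotient_return q_orbits bq); exists g.
have [k kE] := coincidence_mem a0 aD commute j (principal _ _ hE).
have -> : g = k.
  by apply: (act_free_inj (x := x1) to_free); rewrite gt tE E kE.
by rewrite inE; apply/asboolP; exists (j%:~R * l2) => x; rewrite kE.
Qed.
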